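(* Let $f:\mathbb{R}^n\to\mathbb{R}$ be convex and $L$-smooth ($L>0$), attaining its minimum $f^*>-\infty$ at some $x^*\in\mathbb{R}^n$. Let $\{x_k\}$ be the sequence generated by the SGDM recursion $$x_{k+1}=x_k+\frac{k}{k+2}(x_k-x_{k-1})-\frac{2\sqrt{\eta_k}}{(k+2)\sqrt{k}}\,g(x_k,\xi_k),\quad k\in\mathbb{N}_+,\qquad x_1=x_0\in\mathbb{R}^n,$$ with $\eta_k=\frac{1}{16L^2\log^2(k+2)}$, where for some $\sigma>0$ the stochastic gradients satisfy, for every $k\ge 1$ (with $\mathcal{F}_k=\sigma(\xi_1,\dots,\xi_k)$): (i) $\mathbb{E}[g(x_k,\xi_k)\mid\mathcal{F}_{k-1}]=\nabla f(x_k)$; (ii) $\mathbb{E}[\|g(x_k,\xi_k)\|^2\mid\mathcal{F}_{k-1}]\le\|\nabla f(x_k)\|^2+\sigma^2$; (iii) $\mathbb{E}\left[\exp\left(\frac{\|g(x_k,\xi_k)-\nabla f(x_k)\|^2}{\sigma^2}\right)\Big|\,\mathcal{F}_{k-1}\right]\le\exp(1)$. Then there exist constants $C_1,C_2$, depending only on the problem parameters ($f$, $L$, $\sigma$) and the starting point $x_0$ (in particular not on $\beta$, $k$ or $\tau$), such that for every $\beta\in(0,0.5)$, $$\mathbb{P}\left(f(x_k)-f^*\le\frac{\left(C_1+C_2\log\frac1\beta\right)\log(k+2)}{\sqrt{k+1}}\ \text{ for all }k\in\mathbb{N}_+\right)\ge 1-2\beta,$$ and for every $\beta\in(0,0.5)$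 and every stopping time $\tau$, $$\mathbb{P}\left(f(x_\tau)-f^*\le\frac{\left(C_1+C_2\log\frac1\beta\right)\log(\tau+2)}{\sqrt{\tau+1}}\right)\ge 1-2\beta.$$
   Context: $\mathbb{N}_+=\{1,2,\dots\}$; $\log$ is the natural logarithm; $\|\cdot\|$ is the Euclidean norm. $L$-smooth means $f$ is differentiable and $\|\nabla f(x)-\nabla f(y)\|\le L\|x-y\|$ for all $x,y\in\mathbb{R}^n$. The $\xi_k$ are random elements on a common probability space, $g(\cdot,\cdot)$ is a measurable $\mathbb{R}^n$-valued map, $g(x_k,\xi_k)$ is the stochastic gradient at $x_k$, the starting point $x_0$ is deterministic, and $\mathcal{F}_k=\sigma(\xi_1,\dots,\xi_k)$ with $\mathcal{F}_0$ trivial (so $x_k$ is $\mathcal{F}_{k-1}$-measurable for $k\ge1$). A stopping time $\tau$ is an $\mathbb{N}_+$-valued random variable that is a stopping time with respect to the filtration generated by the iterates $\{x_k\}$, i.e. $\{\tau\le k\}\in\sigma(x_0,\dots,x_k)$ for every $k$. *)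

(* Defs.v *)
From HB Require Import structures.
From mathcomp Require Import all_boot all_order all_algebra.
From mathcomp Require Import all_classical all_reals all_analysis.

Set Implicit Arguments.
Unset Strict Implicit.
Unset Printing Implicit Defensive.

Import Order.TTheory GRing.Theory Num.Theory.
Import numFieldNormedType.Exports.

Local Open Scope classical_set_scope.
Local Open Scope ring_scope.

(* The norm [`|v|] of the library on ['rV[R]_n] is the sup norm. *)
Definition norm2 {R : realType} {n : nat} (v : 'rV[R]_n) : R :=
  Num.sqrt (\sum_(i < n) v 0 i ^+ 2).

Definition gradient {R : realType} {n : nat} (f : 'rV[R]_n -> R)
    (x : 'rV[R]_n) : 'rV[R]_n :=
  \row_(i < n) 'D_(delta_mx 0 i) f x.

Definition smooth {R : realType} {n : nat} (L : R) (f : 'rV[R]_n -> R) : Prop :=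
  (forall x, differentiable f x) /\
  (forall x y, norm2 (gradient f x - gradient f y) <= L * norm2 (x - y)).

(* ['rV[R]_n] carries no canonical measurable structure; the sup-norm
   topology is the Euclidean one, so this is the usual Borel sigma-algebra. *)
Definition borelRn (R : realType) (n : nat) :=
  g_sigma_algebraType (@open 'rV[R]_n).

Definition sigma_family {d} {I T : Type} {E : measurableType d} (D : set I)
    (X : I -> T -> E) : set (set T) :=
  <<s \bigcup_(i in D) preimage_set_system setT (X i) measurable >>.

(* [Z] is a version of the conditional expectation of the integrable
   variable [X] given the sigma-algebra generated by [G]; the library's
   [measurable_fun] on [g_sigma_algebraType G] is measurability with respect
   to [<<s G >>], which is [G] when [G] is already a sigma-algebra. *)
Definition is_cond_exp {d} {T : measurableType d} {R : realType}
    (P : probability T R) (G : set (set T)) (X Z : T -> R) : Prop :=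
  [/\ P.-integrable setT (EFin \o X),
      P.-integrable setT (EFin \o Z),
      measurable_fun [set: g_sigma_algebraType G]
        (Z : g_sigma_algebraType G -> R) &
      forall A, <<s G >> A ->
        (\int[P]_(t in A) (X t)%:E = \int[P]_(t in A) (Z t)%:E)%E].

Definition cond_exp_eq {d} {T : measurableType d} {R : realType}
    (P : probability T R) (G : set (set T)) (X Y : T -> R) : Prop :=
  exists2 Z, is_cond_exp P G X Z & {ae P, forall t, Z t = Y t}.

Definition cond_exp_le {d} {T : measurableType d} {R : realType}
    (P : probability T R) (G : set (set T)) (X Y : T -> R) : Prop :=
  exists2 Z, is_cond_exp P G X Z & {ae P, forall t, Z t <= Y t}.

Definition eta {R : realType} (L : R) (k : nat) : R :=
  1 / (16 * L ^+ 2 * ln k.+2%:R ^+ 2).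

(* The variables [xi k] are used for [1 <= k] only. *)
Definition sgdm {R : realType} {n : nat} {T E : Type} (L : R)
    (g : 'rV[R]_n -> E -> 'rV[R]_n) (xi : nat -> T -> E) (x0 : 'rV[R]_n)
    (x : nat -> T -> 'rV[R]_n) : Prop :=
  [/\ forall t, x 0 t = x0,
      forall t, x 1 t = x0 &
      forall k t, (1 <= k)%N ->
        x k.+1 t = x k t + (k%:R / k.+2%:R) *: (x k t - x k.-1 t)
          - (2 * Num.sqrt (eta L k) / (k.+2%:R * Num.sqrt k%:R))
              *: g (x k t) (xi k t)].

(* The sigma-algebra generated by [xi 1, ..., xi k]; trivial for [k = 0]. *)
Definition noise_sigma {d} {T : Type} {E : measurableType d}
    (xi : nat -> T -> E) (k : nat) : set (set T) :=
  sigma_family [set i | (1 <= i <= k)%N] xi.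

Definition stopping_time {R : realType} {n : nat} {T : Type}
    (x : nat -> T -> 'rV[R]_n) (tau : T -> nat) : Prop :=
  (forall t, (1 <= tau t)%N) /\
  (forall k, sigma_family [set i | (i <= k)%N]
               (x : nat -> T -> borelRn R n) [set t | (tau t <= k)%N]).

(* Main.v *)
Require Import Defs.
From HB Require Import structures.
From mathcomp Require Import all_boot all_order all_algebra.
From mathcomp Require Import all_classical all_reals all_analysis.
From mathcomp Require Import measurable_realfun.
From mathcomp Require Import ring lra zify.

Set Implicit Arguments.
Unset Strict Implicit.
Unset Printing Implicit Defensive.

Import Order.TTheory GRing.Theory Num.Theory.
Import numFieldNormedType.Exports.

Local Open Scope classical_set_scope.
Local Open Scope ring_scope.


(** The momentum recursion is plain stochastic gradient descent in disguise: the
    point z_k = x_k + k (x_k - x_(k-1)) satisfies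
    z_(k+1) = z_k - a_k g(x_k, xi_k) with a_k = 1 / (2 L ln(k+2) sqrt k)
    ([sgd_pointS]).  Write xs for the minimiser, e_k for the noise
    g(x_k, xi_k) - grad f(x_k), and track the energy
    W_k = |z_k - xs|^2 + 2 a_k k (f(x_(k-1)) - f(xs)).
    Convexity along z_k - xs = (x_k - xs) + k (x_k - x_(k-1)) makes the
    objective gaps telescope, and since xs minimises a smooth function there is
    a surplus |grad f(x_k)|^2 / (3 L) ([min_coercive]) that pays for the
    gradient part of |g|^2.  What is left ([energy_step]) is the pathwise bound
    W_(k+1) <= W_k - 2 a_k <e_k, z_k - xs> + 4 a_k^2 |e_k|^2.

    The noise is conditionally sub-Gaussian, so the conditional expectation of
    exp (<e, w> + r |e|^2 / sigma^2) is at most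
    exp (9 sigma^2 |w|^2 + 2 r) ([cond_mgf_le]).  With w proportional to
    a_k (z_k - xs), the price of a step is of order a_k^2 |z_k - xs|^2, at most
    a_k^2 W_k; hence it can be absorbed by multiplying the energy by a slowly
    decreasing weight.  With a nondecreasing sequence T_k whose increments
    dominate 36 sigma^2 a_k^2, the potential
    exp (W_k / (1 + T_k) - T_k) is a supermartingale ([potential_step]).  The
    squared steps are summable thanks to the logarithm in the step size, so T_k
    can be chosen bounded: it is the telescoping sequence [compensator].

    The potential starts at a constant.  The maximal inequality for nonnegative
    supermartingales then bounds it at all times at once, except on an event of
    probability beta ([potential_maximal]).  Where it holds, W_k is bounded by an
    affine function of ln (1 / beta), and W_(k+1) contains the objective gap of
    x_k with the coefficient 2 a_(k+1) (k+1), of order sqrt k / ln k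
    ([potential_gap]).  As the bound holds for all k simultaneously, it holds at
    every random time. *)

(** * The Euclidean inner product *)

Section EuclideanSpace.
Context {R : realType} {n : nat}.
Implicit Types (u v w : 'rV[R]_n) (c : R).

Definition dot u v : R := \sum_(i < n) u 0 i * v 0 i.

Lemma dotC u v : dot u v = dot v u.
Proof. by apply: eq_bigr => i _; rewrite mulrC. Qed.

Lemma dotDl u v w : dot (u + v) w = dot u w + dot v w.
Proof. by rewrite -big_split; apply: eq_bigr => i _; rewrite mxE mulrDl. Qed.

Lemma dotZl c u v : dot (c *: u) v = c * dot u v.
Proof. by rewrite mulr_sumr; apply: eq_bigr => i _; rewrite mxE mulrA. Qed.

Lemma dotNl u v : dot (- u) v = - dot u v.
Proof. by rewrite -scaleN1r dotZl mulN1r. Qed.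

Lemma dotBl u v w : dot (u - v) w = dot u w - dot v w.
Proof. by rewrite dotDl dotNl. Qed.

Lemma dotDr u v w : dot u (v + w) = dot u v + dot u w.
Proof. by rewrite dotC dotDl !(dotC u). Qed.

Lemma dotZr c u v : dot u (c *: v) = c * dot u v.
Proof. by rewrite dotC dotZl dotC. Qed.

Lemma dotNr u v : dot u (- v) = - dot u v.
Proof. by rewrite dotC dotNl dotC. Qed.

Lemma dotBr u v w : dot u (v - w) = dot u v - dot u w.
Proof. by rewrite dotDr dotNr. Qed.

Lemma dot_ge0 u : 0 <= dot u u.
Proof. by apply: sumr_ge0 => i _; rewrite -expr2 sqr_ge0. Qed.

Lemma norm2_sqr u : norm2 u ^+ 2 = dot u u.
Proof.
rewrite sqr_sqrtr; first by apply: eq_bigr => i _; rewrite expr2.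
by apply: sumr_ge0 => i _; rewrite sqr_ge0.
Qed.

Lemma norm2_ge0 u : 0 <= norm2 u.
Proof. exact: sqrtr_ge0. Qed.

Lemma dot_self_eq0 u : dot u u = 0 -> u = 0.
Proof.
move=> /eqP; rewrite psumr_eq0; last by move=> i _; rewrite -expr2 sqr_ge0.
move=> /allP u0; apply/rowP => i; rewrite mxE.
by have := u0 i; rewrite mem_index_enum mulf_eq0 orbb => /(_ isT)/eqP.
Qed.

Lemma dot_cauchy_schwarz u v : dot u v ^+ 2 <= dot u u * dot v v.
Proof.
have [v0|v0] := eqVneq (dot v v) 0.
  rewrite (dot_self_eq0 v0) -(scale0r 0) !dotZr !mul0r mulr0.
  by rewrite expr0n.
have vgt0 : 0 < dot v v by rewrite lt_neqAle eq_sym v0 dot_ge0.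
have := dot_ge0 (dot v v *: u - dot u v *: v).
rewrite !dotBl !dotBr !dotZl !dotZr (dotC v u).
rewrite [X in 0 <= X](_ : _ = dot v v * (dot u u * dot v v - dot u v ^+ 2)).
  by rewrite pmulr_rge0// subr_ge0.
ring.
Qed.

End EuclideanSpace.

(** * Smooth convex functions near a minimiser *)

Section SmoothConvex.
Context {R : realType} {n : nat}.
Variables (f : 'rV[R]_n -> R) (L : R).
Hypotheses (L_gt0 : 0 < L)
  (f_convex : convex_function [set: convex_lmodType 'rV[R]_n] f)
  (f_smooth : smooth L f).
Implicit Types x y v : 'rV[R]_n.

Lemma derive_gradient x v : 'D_v f x = dot (gradient f x) v.
Proof.
have df : differentiable f x := f_smooth.1 x.
rewrite deriveE// {1}(row_sum_delta v) linear_sum; apply: eq_bigr => i _.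
by rewrite linearZ /= mxE deriveE// mulrC.
Qed.

Lemma convex_segment x y (t : R) : 0 <= t <= 1 ->
  f (x + t *: (y - x)) <= f x + t * (f y - f x).
Proof.
move=> /andP[t0 t1].
have := f_convex (Itv01 t0 t1) (in_setT y) (in_setT x).
rewrite /conv /= /unstable.onem.
rewrite (_ : t *: y + (1 - t) *: x = x + t *: (y - x)); last first.
  by rewrite scalerBl scale1r scalerBr addrCA.
move=> /le_trans; apply; rewrite /GRing.scale /=.
change (t * f y + (1 - t) * f x <= f x + t * (f y - f x)).
lra.
Qed.

Lemma derive_right x v :
  h^-1 * (f (x + h *: v) - f x) @[h --> 0^'+] --> 'D_v f x.
Proof.
have fxv : derivable f x v by apply/diff_derivable/f_smooth.1.
have /cvg_ex[l fl] := fxv.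
rewrite /derive (cvg_lim _ fl)//.
have := cvg_dnbhs_at_right fl.
rewrite (_ : (fun h : R => h^-1 *: _) =
  (fun h => h^-1 * (f (x + h *: v) - f x)))//.
by apply/funext => h /=; rewrite [h *: v + x]addrC.
Qed.

(** The right difference quotients of a convex function along y - x are at most
    f y - f x, and they tend to the directional derivative. *)
Lemma gradient_le x y : f x + dot (gradient f x) (y - x) <= f y.
Proof.
rewrite -derive_gradient -lerBrDl.
apply: (cvgr_to_le (@derive_right x (y - x))).
near=> h.
have h0 : 0 < h by [].
rewrite mulrC ler_pdivrMr// mulrC lerBlDl.
apply: convex_segment; rewrite (ltW h0) /=.
by near: h; exact: nbhs_right_le.
Unshelve. all: by end_near. Qed.

Lemma gradient_min x : (forall y, f x <= f y) -> gradient f x = 0.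
Proof.
move=> fmin; apply: dot_self_eq0; apply/le_anti; rewrite dot_ge0 andbT.
rewrite -oppr_ge0 -dotNr -derive_gradient.
apply: (cvgr_to_ge (@derive_right x (- gradient f x))); near=> h.
have h0 : 0 < h by [].
by rewrite mulr_ge0 ?invr_ge0 ?(ltW h0)// subr_ge0.
Unshelve. all: by end_near. Qed.

Lemma smooth_dot x u : dot (gradient f (x + u) - gradient f x) u <= L * dot u u.
Proof.
set a := (X in dot X u).
have au : dot a a <= L ^+ 2 * dot u u.
  rewrite -!norm2_sqr -exprMn.
  have := f_smooth.2 (x + u) x; rewrite [x + u - x]addrC addKr.
  move=> aL; apply: lerXn2r; rewrite ?nnegrE ?norm2_ge0//.
  by rewrite mulr_ge0 ?norm2_ge0 ?(ltW L_gt0).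
have := dot_ge0 (a - L *: u).
move: au; move: a => a au.
rewrite dotBl !dotBr !dotZl !dotZr (dotC u a) => h.
rewrite -(ler_pM2l L_gt0); lra.
Qed.

(** Move from the minimiser xs by 2u, where u is a multiple of the gradient at
    x: the tangent at x forces f to grow linearly along u, while smoothness at
    xs allows quadratic growth only.  Bounding the growth in two half-steps by
    [smooth_dot] gives 3 L |u|^2 without integrating the gradient; the multiple
    1 / (3 L) maximises the difference. *)
Lemma min_coercive xs x : (forall y, f xs <= f y) ->
  f x + dot (gradient f x) (xs - x) +
    dot (gradient f x) (gradient f x) / (3 * L) <= f xs.
Proof.
move=> fmin; set G := gradient f x.
pose u := (3 * L)^-1 *: G.
have L0 : L != 0 by rewrite gt_eqF.
have g0 := gradient_min fmin.
have h1 := gradient_le (xs + u) xs.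
have h2 := gradient_le (xs + (u + u)) (xs + u).
have h3 := gradient_le x (xs + (u + u)).
have s1 := smooth_dot xs u.
have s2 := smooth_dot xs (u + u).
have e1 : xs - (xs + u) = - u by rewrite opprD addrA subrr add0r.
have e2 : xs + u - (xs + (u + u)) = - u.
  by rewrite addrA opprD addrA subrr add0r.
have e3 : xs + (u + u) - x = (xs - x) + (u + u) by rewrite addrAC.
move: h1 h2 h3 s1 s2; rewrite e1 e2 e3 g0 !subr0 !dotDr !dotNr -/G.
rewrite {e1 e2 e3}.
rewrite !(dotDl u u).
set G1 := gradient _ _; set G2 := gradient _ _ => h1 h2 h3 s1 s2.
have Gu : dot G u = dot G G / (3 * L) by rewrite dotZr mulrC.
have uu : L * dot u u = dot G G / (9 * L).
  by rewrite /u dotZr dotZl; field.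
have L3 : dot G G / (9 * L) * 3 = dot G G / (3 * L) by field.
move: h1 h2 h3 s1 s2 Gu uu L3; clear.
move: (dot G u) (dot G1 u) (dot G2 u) (dot u u) (dot G xs) (dot G x).
move: (dot G G / _) (dot G G / _) => *.
lra.
Qed.

End SmoothConvex.

(** * One step of the method, along a fixed path *)

Section MomentumStep.
Context {R : realType} {n : nat}.
Variables (f : 'rV[R]_n -> R) (L : R) (xs : 'rV[R]_n).
Hypotheses (L_gt0 : 0 < L)
  (f_convex : convex_function [set: convex_lmodType 'rV[R]_n] f)
  (f_smooth : smooth L f)
  (xs_min : forall y, f xs <= f y).

(** Expand |z - a g - xs|^2 with g = grad f x + e.  The inner product
    <grad f x, z - xs> splits along x - xs and k (x - x'): the first part is
    bounded by [min_coercive], the second one by the tangent inequality at x', so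
    that the gaps appear as (k + 1) (f x - f xs) - k (f x' - f xs).  The term
    a^2 |g|^2 is split as 4/3 |grad f x|^2 + 4 |e|^2, and the factor 4/3 is what
    the surplus |grad f x|^2 / (3 L) affords when 2 L a <= 1. *)
Lemma momentum_step (x x' g z e : 'rV[R]_n) (a k : R) :
  z = x + k *: (x - x') -> e = g - gradient f x ->
  0 <= a -> 2 * L * a <= 1 -> 0 <= k ->
  dot (z - a *: g - xs) (z - a *: g - xs) + 2 * a * (k + 1) * (f x - f xs) <=
  dot (z - xs) (z - xs) + 2 * a * k * (f x' - f xs)
    - 2 * a * dot e (z - xs) + 4 * a ^+ 2 * dot e e.
Proof.
move=> zE eE a0 aL k0.
have h1 := min_coercive L_gt0 f_convex f_smooth x xs_min.
have h2 := gradient_le f_convex f_smooth x x'.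
have h3 := dot_ge0 (gradient f x - 3 *: e).
have L0 : L != 0 by rewrite gt_eqF.
have -> : g = gradient f x + e by rewrite eE addrC subrK.
have -> : z - a *: (gradient f x + e) - xs = (z - xs) - a *: (gradient f x + e).
  by rewrite addrAC.
have dz : dot (gradient f x) (z - xs) =
    - dot (gradient f x) (xs - x) - k * dot (gradient f x) (x' - x).
  by rewrite zE !(dotDr, dotNr, dotZr); ring.
move: h1 h2 h3 dz; move: (z - xs) (xs - x) (x' - x).
move: (gradient f x) => G {z zE eE g} z u v.
rewrite !(dotNl, dotNr, dotDl, dotDr, dotZl, dotZr).
rewrite (dotC e G) (dotC z e) (dotC z G) => h1 h2 h3 ->.
have GG := dot_ge0 G.
have h4 : a ^+ 2 * dot G G * (4 / 3) <= 2 * a * (dot G G / (3 * L)).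
  have -> : 2 * a * (dot G G / (3 * L)) = a * dot G G * (2 / 3) / L by field.
  by rewrite ler_pdivlMr//; move: (mulr_ge0 a0 GG); nra.
have h5 : 2 * a * (f x - f xs + dot G G / (3 * L)) <= - (2 * a * dot G u).
  have : 0 <= f xs - (f x + dot G u + dot G G / (3 * L)) by lra.
  by move=> /(mulr_ge0 a0); lra.
have h6 : 2 * a * k * (f x - f x') <= - (2 * a * k * dot G v).
  have : 0 <= f x' - (f x + dot G v) by lra.
  by move=> /(mulr_ge0 (mulr_ge0 a0 k0)); lra.
have h7 : 0 <= a ^+ 2 * (dot G G - 3 * dot G e - 3 * (dot G e - 3 * dot e e)).
  by apply: mulr_ge0; [exact: sqr_ge0|lra].
lra.
Qed.

End MomentumStep.

(** * Pointwise exponential bounds *)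

Section ExpInequalities.
Context {R : realType}.
Implicit Types (u v s q r p : R).

Lemma expR1_le3 : expR 1 <= 3 :> R.
Proof.
(* 1 / e is at least (7 / 8)^8, which exceeds 1 / 3. *)
have h : 7 / 8 <= expR (- (1 / 8)) :> R.
  by apply: le_trans (expR_ge1Dx _); lra.
have h8 : (7 / 8) ^+ 8 <= expR (- 1) :> R.
  have -> : - 1 = 8%:R * - (1 / 8) :> R by lra.
  rewrite expRM_natl; apply: lerXn2r => //; rewrite nnegrE ?expR_ge0//; lra.
have e0 := expR_gt0 (1 : R).
have : expR 1 * expR (- 1) = 1 :> R by rewrite -expRD subrr expR0.
have h3 : 1 / 3 <= expR (-1) :> R by apply: le_trans h8; lra.
nra.
Qed.

Lemma expR_le_addr_sqr u : expR u <= u + expR (2 * u ^+ 2).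
Proof.
have [hu|hu] := lerP u (1 / 2); last first.
  have : expR u <= expR (2 * u ^+ 2) by rewrite ler_expR; nra.
  by lra.
have h : expR u <= 1 + u + 2 * u ^+ 2.
  have h1 := expR_ge1Dx (- u).
  have e0 := expR_gt0 u.
  have e1 : expR u * expR (- u) = 1 by rewrite -expRD subrr expR0.
  have e2 : expR u * (1 - u) <= 1 by rewrite -[X in _ <= X]e1 ler_pM2l.
  have u1 : 0 < 1 - u by lra.
  rewrite -(ler_pM2r u1); apply: le_trans e2 _.
  have : 0 <= u ^+ 2 * (1 - 2 * u) by apply: mulr_ge0; [exact: sqr_ge0|lra].
  lra.
by have := expR_ge1Dx (2 * u ^+ 2); lra.
Qed.

Lemma expR_le_chord p s : 0 <= p <= 1 -> expR (p * s) <= 1 - p + p * expR s.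
Proof.
move=> /andP[p0 p1].
have y0 := expR_gt0 (p * s).
have e1 : expR s = expR (p * s) * expR ((1 - p) * s).
  by rewrite -expRD; congr expR; ring.
have e2 : 1 = expR (p * s) * expR (- (p * s)) by rewrite -expRD subrr expR0.
have h1 : expR (p * s) * (1 + (1 - p) * s) <= expR s.
  by rewrite e1 ler_pM2l// expR_ge1Dx.
have h2 : expR (p * s) * (1 - p * s) <= 1.
  by rewrite [X in _ <= X]e2 ler_pM2l// expR_ge1Dx.
have q0 : 0 <= 1 - p by lra.
have := ler_wpM2l p0 h1; have := ler_wpM2l q0 h2; lra.
Qed.

(** The exponential exp (u + r s), with u linear in the noise and s its
    normalised square norm, is dominated by
    mgf_lin q * u + mgf_cst q r + mgf_exp q r * exp s.  The expectation of each
    of the three terms is controlled by assumption: u is centred and exp s has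
    mean at most e.  The coefficients depend on the past only; for small q they
    keep the centred term, which is what makes the mean 1 + O(q + r), and for
    large q a crude bound is enough. *)
Definition mgf_lin q : R := if q <= 1 / 8 then 1 else 0.
Definition mgf_cst q r : R := if q <= 1 / 8 then 1 - (4 * q + r) else 0.
Definition mgf_exp q r : R := if q <= 1 / 8 then 4 * q + r else expR (q / 2).

(** For q <= 1/8, split exp (u + r s) by the mean inequality into halves of
    exp (2 u) and exp (2 r s); the first one is at most 2 u + exp (8 q s), and the
    chord bound linearises both exponentials in exp s.  For q > 1/8, use
    u <= (s + q) / 2. *)
Lemma expR_le_mgf u s q r : 0 <= s -> 0 <= q -> 0 <= r <= 1 / 2 ->
  u ^+ 2 <= q * s ->
  expR (u + r * s) <= mgf_lin q * u + mgf_cst q r + mgf_exp q r * expR s.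
Proof.
move=> s0 q0 /andP[r0 r1] uqs; rewrite /mgf_lin /mgf_cst /mgf_exp.
case: ifPn => [q8|]; last first.
  rewrite -ltNge => q8; rewrite mul0r !add0r -expRD ler_expR.
  have : u <= (s + q) / 2.
    rewrite leNgt; apply/negP => hu.
    have : ((s + q) / 2) ^+ 2 < u ^+ 2 by rewrite ltrXn2r//; lra.
    have := sqr_ge0 (s - q); lra.
  nra.
have h1 : expR (u + r * s) <= (expR (2 * u) + expR (2 * r * s)) / 2.
  rewrite expRD.
  have -> : expR (2 * u) = expR u ^+ 2 by rewrite -expRM_natl mulr_natl.
  have -> : expR (2 * r * s) = expR (r * s) ^+ 2.
    by rewrite -expRM_natl -mulrA mulr_natl.
  have := sqr_ge0 (expR u - expR (r * s)); lra.
have h2 := expR_le_addr_sqr (2 * u).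
have h3 : expR (2 * (2 * u) ^+ 2) <= expR (8 * q * s).
  by rewrite ler_expR; lra.
have h4 := @expR_le_chord (8 * q) s (ltac:(lra)).
have h5 := @expR_le_chord (2 * r) s (ltac:(lra)).
lra.
Qed.

Lemma mgf_exp_ge0 q r : 0 <= q -> 0 <= r -> 0 <= mgf_exp q r.
Proof.
rewrite /mgf_exp => q0 r0; case: ifP => _; [lra|exact: expR_ge0].
Qed.

(** This is the mean of the dominating expression of [expR_le_mgf]; when q > 1/8,
    the additive constant 1 is absorbed in 8 q. *)
Lemma mgf_coef_le q r : 0 <= q -> 0 <= r ->
  mgf_cst q r + mgf_exp q r * expR 1 <= expR (9 * q + 2 * r).
Proof.
move=> q0 r0; rewrite /mgf_cst /mgf_exp; case: ifPn => [q8|]; last first.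
  by rewrite -ltNge => q8; rewrite add0r -expRD ler_expR; lra.
have := @ler_wpM2l _ (4 * q + r) (ltac:(lra)) _ _ expR1_le3.
have := expR_ge1Dx (9 * q + 2 * r).
lra.
Qed.

End ExpInequalities.

(** * Conditional expectations *)

Lemma measurable_sublevel {d} {T : measurableType d} {R : realType}
    (a : T -> R) (c : R) :
  measurable_fun setT a -> measurable [set t | a t <= c].
Proof.
move=> ma; have := ma measurableT _ (measurable_itv `]-oo, c]).
by rewrite setTI (_ : a @^-1` _ = [set t | a t <= c]).
Qed.

Local Notation measurable_wrt F h :=
  (measurable_fun [set: g_sigma_algebraType F] (h : g_sigma_algebraType F -> _)).

Section ConditionalExpectation.
Context {d} {T : measurableType d} {R : realType} (P : probability T R).
Variable F : set (set T).
Hypothesis F_sub : <<s F >> `<=` measurable.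
Implicit Types (a X Y Z : T -> R) (G : set T) (M : R).

Lemma measurable_coarse d' (U : measurableType d') (h : T -> U) :
  measurable_wrt F h ->
  measurable_fun [set: T] h.
Proof. by move=> mh _ A mA; apply: F_sub; exact: mh. Qed.

Lemma integrable_boundedM G a X M : measurable G ->
  measurable_fun setT a -> (forall t, G t -> `|a t| <= M) ->
  P.-integrable setT (EFin \o X) -> P.-integrable G (EFin \o (a \* X)%R).
Proof.
move=> mG ma aM iX.
have -> : EFin \o (a \* X)%R = ((EFin \o a) \* (EFin \o X))%E.
  by apply/funext => t; rewrite /= EFinM.
apply: integrableMr => //.
- exact: measurable_funTS.
- exists M; split; first exact: num_real.
  by move=> x Mx t Gt; apply: le_trans (ltW Mx); exact: aM.
- by apply: integrableS iX.
Qed.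

(** Cut G at the level M / 2 of a.  On the upper part, subtracting M / 2 from a
    does not change the integral, because Y has integral zero there; so on both
    parts the weight takes values in [0, M / 2], and the trivial bound
    M * int |Y| is halved at each round. *)
Lemma null_pull_out_bisect (m : nat) Y G a M :
  P.-integrable setT (EFin \o Y) ->
  (forall A, <<s F >> A -> \int[P]_(t in A) Y t = 0) ->
  measurable_wrt F a ->
  <<s F >> G -> (forall t, G t -> 0 <= a t <= M) ->
  `|\int[P]_(t in G) (a t * Y t)| <= M / 2 ^+ m * \int[P]_(t in G) `|Y t|.
Proof.
move=> iY Y0; elim: m G a M => [|m IH] G a M ma FG aM.
  have mG := F_sub FG.
  have mTa := measurable_coarse ma.
  have iaY : P.-integrable G (EFin \o (a \* Y)).
    apply: (@integrable_boundedM _ _ _ M) => // t /aM/andP[a0 ?].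
    by rewrite ger0_norm.
  have iYG : P.-integrable G (EFin \o Y) by apply: integrableS iY.
  have iYn := integrable_norm iYG.
  apply: le_trans (le_normr_Rintegral mG iaY) _.
  rewrite expr0 divr1 -RintegralZl//.
  apply: le_Rintegral => //.
  - exact: (integrable_norm iaY).
  - have -> : EFin \o (fun x => M * `|Y x|) = (fun x => M%:E * (`|Y x|)%:E)%E.
      by apply/funext => t; rewrite /= EFinM.
    exact: (integrableZl mG M iYn).
  - move=> t /aM/andP[a0 ?]; rewrite normrM ger0_norm//.
    exact: ler_wpM2r.
have mTa := measurable_coarse ma.
pose G1 := G `&` [set t | a t <= M / 2].
pose G2 := G `\` [set t | a t <= M / 2].
have FH : <<s F >> [set t | a t <= M / 2] :=
  @measurable_sublevel _ (g_sigma_algebraType F) _ _ (M / 2) ma.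
have FG1 : <<s F >> G1 := @measurableI _ (g_sigma_algebraType F) _ _ FG FH.
have FG2 : <<s F >> G2 := @measurableD _ (g_sigma_algebraType F) _ _ FG FH.
have GE : G = G1 `|` G2 by rewrite /G1 /G2 setUIDK.
have dG : [disjoint G1 & G2].
  by apply/disj_setPS => t [[_ h] [_ /(_ h)]].
have [mG mG1 mG2] : [/\ measurable G, measurable G1 & measurable G2].
  by split; exact: F_sub.
have iaY : P.-integrable G (EFin \o (a \* Y)).
  apply: (@integrable_boundedM _ _ _ M) => // t /aM/andP[a0 ?].
  by rewrite ger0_norm.
have iYG : P.-integrable G (EFin \o Y) by apply: integrableS iY.
have iYn := integrable_norm iYG.
have IH1 := IH G1 a (M / 2) ma FG1.
have ma2 : measurable_wrt F (fun t => a t - M / 2).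
  by apply: measurable_funB.
have IH2 := IH G2 (fun t => a t - M / 2) (M / 2) ma2 FG2.
have eG2 : \int[P]_(t in G2) (a t * Y t) =
    \int[P]_(t in G2) ((a t - M / 2) * Y t).
  have iYG2 : P.-integrable G2 (EFin \o Y) by apply: integrableS iY.
  have iaY2 : P.-integrable G2 (EFin \o (a \* Y)).
    by apply: integrableS iaY => //; rewrite GE; exact: subsetUr.
  have iMY2 : P.-integrable G2 (EFin \o ((cst (M / 2)) \* Y)).
    apply: (@integrable_boundedM _ _ _ `|M / 2|) => //.
  under [RHS]eq_Rintegral do rewrite mulrBl.
  by rewrite RintegralB// RintegralZl// Y0// mulr0 subr0.
have intG2 : `|\int[P]_(t in G2) (a t * Y t)| <=
    M / 2 / 2 ^+ m * \int[P]_(t in G2) `|Y t|.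
  rewrite eG2; apply: IH2 => t [/aM/andP[a0 a1]] /negP; rewrite -ltNge => h.
  by apply/andP; split; lra.
have intG1 : `|\int[P]_(t in G1) (a t * Y t)| <=
    M / 2 / 2 ^+ m * \int[P]_(t in G1) `|Y t|.
  by apply: IH1 => t [/aM/andP[a0 a1] h]; apply/andP.
rewrite GE !Rintegral_setU -?GE//.
apply: le_trans (ler_normD _ _) _.
rewrite mulrDr exprS invfM !mulrA.
exact: lerD.
Qed.

Lemma null_pull_out Y G a M :
  P.-integrable setT (EFin \o Y) ->
  (forall A, <<s F >> A -> \int[P]_(t in A) Y t = 0) ->
  measurable_wrt F a ->
  <<s F >> G -> (forall t, G t -> `|a t| <= M) ->
  \int[P]_(t in G) (a t * Y t) = 0.
Proof.
move=> iY Y0 ma FG aM.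
have mG := F_sub FG.
have mTa := measurable_coarse ma.
have iYG : P.-integrable G (EFin \o Y) by apply: integrableS iY.
have iaY : P.-integrable G (EFin \o (a \* Y)).
  exact: (@integrable_boundedM _ _ _ M).
have iMY : P.-integrable G (EFin \o ((cst M) \* Y)).
  by apply: (@integrable_boundedM _ _ _ `|M|) => //.
have maM : measurable_wrt F (fun t => a t + M).
  exact: measurable_funD.
have -> : \int[P]_(t in G) (a t * Y t) = \int[P]_(t in G) ((a t + M) * Y t).
  under [RHS]eq_Rintegral do rewrite mulrDl.
  by rewrite RintegralD// RintegralZl// Y0// mulr0 addr0.
have B m := @null_pull_out_bisect m Y G (fun t => a t + M) (2 * M) iY Y0 maM FG.
apply/eqP; rewrite -normr_le0 leNgt; apply/negP => h.
set c := `|_| in h B.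
set K := \int[P]_(t in G) `|Y t| in B.
have {}B m : c <= 2 * M / 2 ^+ m * K.
  by apply: B => t /aM; rewrite ler_norml => /andP[? ?]; apply/andP; split; lra.
have := B (Num.bound (2 * M * K / c)).
set m := Num.bound _ => Bm.
have hm : 2 * M * K / c < 2 ^+ m by exact: upper_nthrootP.
move: hm; rewrite ltr_pdivrMr// ltNge => /negP; apply.
by rewrite mulrC -ler_pdivlMr ?exprn_gt0// mulrAC.
Qed.

(** Weights known from the past can be pulled out: a version Z of the conditional
    expectation makes X - Z integrate to zero over the whole sigma-algebra, and
    Z = Y almost everywhere. *)
Lemma cond_exp_eq_pull_out X Y G a M :
  cond_exp_eq P F X Y -> measurable_fun setT Y ->
  measurable_wrt F a ->
  <<s F >> G -> (forall t, G t -> `|a t| <= M) ->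
  P.-integrable G (EFin \o (fun t => a t * (X t - Y t))) /\
  \int[P]_(t in G) (a t * (X t - Y t)) = 0.
Proof.
move=> [Z [iX iZ mZ XZ] ZY] mY ma FG aM.
have mG := F_sub FG.
have mTa := measurable_coarse ma.
have mTZ := measurable_coarse mZ.
have ZYe : ae_eq P setT (EFin \o Z) (EFin \o Y).
  by apply: filterS ZY => t ZYt _ /=; rewrite ZYt.
have iY : P.-integrable setT (EFin \o Y).
  apply/integrableP; split; first exact/measurable_EFinP.
  have /integrableP[_] := iZ; apply: le_lt_trans.
  rewrite le_eqVlt; apply/orP; left; apply/eqP; apply: ae_eq_integral => //.
  - by do 2 apply: measurableT_comp => //.
  - by do 2 apply: measurableT_comp => //.
  - by apply: filterS ZY => t ZYt _ /=; rewrite ZYt.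
have iXY : P.-integrable setT (EFin \o (X \- Y)).
  by have := integrableB measurableT iX iY.
split; first exact: (@integrable_boundedM _ _ _ M).
apply: (null_pull_out iXY _ ma FG aM) => A FA.
have mA := F_sub FA.
have iXA : P.-integrable A (EFin \o X) by apply: integrableS iX.
have iYA : P.-integrable A (EFin \o Y) by apply: integrableS iY.
rewrite RintegralB// /Rintegral XZ//.
rewrite (@ae_eq_integral _ _ _ P A (EFin \o Y) (EFin \o Z))//.
- by rewrite subrr.
- exact/measurable_EFinP/measurable_funTS.
- exact/measurable_EFinP/measurable_funTS.
- by apply: filterS ZYe => t /(_ I).
Qed.

Lemma cond_exp_le_pull_out X c G a M :
  cond_exp_le P F X (fun=> c) ->
  measurable_wrt F a ->
  <<s F >> G -> (forall t, G t -> 0 <= a t <= M) ->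
  P.-integrable G (EFin \o (fun t => a t * X t)) /\
  \int[P]_(t in G) (a t * X t) <= \int[P]_(t in G) (a t * c).
Proof.
move=> [Z [iX iZ mZ XZ] Zc] ma FG aM.
have mG := F_sub FG.
have mTa := measurable_coarse ma.
have mTZ := measurable_coarse mZ.
have aM' t : G t -> `|a t| <= M by move=> /aM/andP[a0 ?]; rewrite ger0_norm.
have iaX : P.-integrable G (EFin \o (a \* X)).
  by apply: (integrable_boundedM mG mTa aM').
split => //.
have iaZ : P.-integrable G (EFin \o (a \* Z)).
  by apply: (integrable_boundedM mG mTa aM').
have ic : P.-integrable setT (EFin \o (cst c)).
  exact: finite_measure_integrable_cst.
have iac : P.-integrable G (EFin \o (a \* (cst c))).
  by apply: (integrable_boundedM mG mTa aM').
have iXZ : P.-integrable setT (EFin \o (X \- Z)).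
  by have := integrableB measurableT iX iZ.
have h0 : \int[P]_(t in G) (a t * (X t - Z t)) = 0.
  apply: (null_pull_out iXZ _ ma FG aM') => A FA.
  have mA := F_sub FA.
  have iXA : P.-integrable A (EFin \o X) by apply: integrableS iX.
  have iZA : P.-integrable A (EFin \o Z) by apply: integrableS iZ.
  by rewrite RintegralB// /Rintegral XZ// subrr.
have -> : \int[P]_(t in G) (a t * X t) = \int[P]_(t in G) (a t * Z t).
  apply/eqP; rewrite -subr_eq0 -[X in _ == X]h0 -RintegralB//.
  by apply/eqP; apply: eq_Rintegral => t _; rewrite mulrBr.
rewrite -subr_ge0 -RintegralB//.
(* c - Z is nonnegative only almost everywhere: take its positive part. *)
have -> : \int[P]_(t in G) (a t * c - a t * Z t) =
    \int[P]_(t in G) (a t * Num.max (c - Z t) 0).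
  rewrite /Rintegral; congr fine; apply: ae_eq_integral => //.
  - by have := measurable_int _ (integrableB mG iac iaZ).
  - apply/measurable_EFinP/measurable_funTS; apply: measurable_funM => //.
    by apply: measurable_maxr => //; exact: measurable_funB.
  - apply: filterS Zc => t Zt _ /=; rewrite -mulrBr; congr (_ * _)%:E.
    by rewrite max_l// subr_ge0.
apply: Rintegral_ge0 => t /aM/andP[a0 _].
by rewrite mulr_ge0// le_max lexx orbT.
Qed.

End ConditionalExpectation.

(** * The conditional moment generating function of sub-Gaussian noise *)

Section ConditionalMgf.
Context {d} {T : measurableType d} {R : realType} (P : probability T R).
Context {n : nat}.
Variables (F : set (set T)) (g m : T -> 'rV[R]_n) (sigma : R).
Hypotheses (F_sub : <<s F >> `<=` measurable) (sigma_gt0 : 0 < sigma).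
Hypothesis m_meas : forall i, measurable_fun setT (fun t => m t 0 i).
Hypothesis g_mean : forall i,
  cond_exp_eq P F (fun t => g t 0 i) (fun t => m t 0 i).
Hypothesis g_exp : cond_exp_le P F
  (fun t => expR (norm2 (g t - m t) ^+ 2 / sigma ^+ 2)) (fun=> expR 1).

Lemma measurable_dot d' (U : measurableType d') (u v : U -> 'rV[R]_n) :
  (forall i, measurable_fun setT (fun t => u t 0 i)) ->
  (forall i, measurable_fun setT (fun t => v t 0 i)) ->
  measurable_fun setT (fun t => dot (u t) (v t)).
Proof.
move=> mu mv; rewrite /dot.
apply: measurable_sum => i; exact: measurable_funM.
Qed.

Lemma Rintegral_leD2l (D : set T) (a b c : T -> R) : measurable D ->
  P.-integrable D (EFin \o a) -> P.-integrable D (EFin \o b) ->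
  P.-integrable D (EFin \o c) -> \int[P]_(t in D) b t <= \int[P]_(t in D) c t ->
  \int[P]_(t in D) (a t + b t) <= \int[P]_(t in D) (a t + c t).
Proof. by move=> mD ia ib ic bc; rewrite !RintegralD// lerD2l. Qed.

(** The integrated form, over events G of the past, of the bound
    E[exp (<g - m, w> + r |g - m|^2 / sigma^2) | F] <= exp (9 q + 2 r): dominate
    the exponential pointwise by [expR_le_mgf] and pull the coefficients out of
    the three terms.  Boundedness of Q and q on G is what makes these
    coefficients bounded. *)
Lemma cond_mgf_le (G : set T) (Q : T -> R) (w : T -> 'rV[R]_n) (r M : R) :
  let q t := sigma ^+ 2 * dot (w t) (w t) in
  <<s F >> G -> 0 <= r <= 1 / 2 ->
  measurable_wrt F Q ->
  (forall i, measurable_wrt F (fun t => w t 0 i)) ->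
  (forall t, G t -> 0 <= Q t <= M) -> (forall t, G t -> q t <= M) ->
  let X t := Q t * expR (dot (g t - m t) (w t) +
     r * (norm2 (g t - m t) ^+ 2 / sigma ^+ 2)) in
  P.-integrable G (EFin \o X) /\
  \int[P]_(t in G) X t <= \int[P]_(t in G) (Q t * expR (9 * q t + 2 * r)).
Proof.
move=> q FG r01 mQ mw QM qM X.
have /andP[r0 r1] := r01.
have mG := F_sub FG.
have mq : measurable_wrt F q.
  by apply: measurable_funM => //; exact: measurable_dot.
have mq8 : measurable_wrt F (fun t => q t <= 1 / 8).
  exact: measurable_fun_ler.
pose aL i t := Q t * mgf_lin (q t) * w t 0 i.
pose aC t := Q t * mgf_cst (q t) r.
pose aE t := Q t * mgf_exp (q t) r.
have maL i : measurable_wrt F (aL i).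
  apply: measurable_funM => //; apply: measurable_funM => //.
  by apply: measurable_fun_ifT.
have maC : measurable_wrt F aC.
  apply: measurable_funM => //; apply: measurable_fun_ifT => //.
  apply: measurable_funB => //; apply: measurable_funD => //.
  exact: measurable_funM.
have maE : measurable_wrt F aE.
  apply: measurable_funM => //; apply: measurable_fun_ifT => //.
    by apply: measurable_funD => //; exact: measurable_funM.
  by apply: measurableT_comp => //; exact: measurable_funM.
have s20 : 0 < sigma ^+ 2 by rewrite exprn_gt0.
have q0 t : 0 <= q t by rewrite mulr_ge0 ?dot_ge0// ltW.
(* The coordinates of w are bounded on G since sigma^2 |w|^2 <= M there. *)
have aLM i t : G t -> `|aL i t| <= M * (1 + M / sigma ^+ 2).
  move=> Gt; have /andP[Q0 QtM] := QM t Gt; have qtM := qM t Gt.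
  have wi : `|w t 0 i| <= 1 + M / sigma ^+ 2.
    have wi2 : `|w t 0 i| ^+ 2 <= M / sigma ^+ 2.
      rewrite ler_pdivlMr// mulrC; apply: le_trans qtM.
      rewrite ler_pM2l// real_normK ?num_real// /dot (bigD1 i)//= -expr2.
      by rewrite lerDl sumr_ge0// => j _; rewrite -expr2 sqr_ge0.
    have := sqr_ge0 (`|w t 0 i| - 1); have := normr_ge0 (w t 0 i); nra.
  rewrite normrM; apply: ler_pM => //.
  rewrite normrM ger0_norm// -[leRHS]mulr1; apply: ler_pM => //.
  by rewrite /mgf_lin; case: ifP; rewrite ?normr1 ?normr0.
have aCM t : G t -> `|aC t| <= M.
  move=> Gt; have /andP[Q0 QtM] := QM t Gt.
  rewrite normrM ger0_norm// -[leRHS]mulr1; apply: ler_pM => //.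
  rewrite /mgf_cst; case: ifP; rewrite ?normr0// => q8.
  by have := q0 t; rewrite ler_norml => ?; apply/andP; split; lra.
have aEM t : G t -> 0 <= aE t <= M * expR (M / 2).
  move=> Gt; have /andP[Q0 QtM] := QM t Gt.
  have qtM := qM t Gt; have qt0 := q0 t.
  have e0 := mgf_exp_ge0 qt0 r0.
  rewrite mulr_ge0//=; apply: ler_pM => //.
  rewrite /mgf_exp; case: ifP => q8; last by rewrite ler_expR; lra.
  by apply: le_trans (expR_ge1Dx _); lra.
have iL i :=
  cond_exp_eq_pull_out F_sub (g_mean i) (m_meas i) (maL i) FG (@aLM i).
have [iE EE] := cond_exp_le_pull_out F_sub g_exp maE FG aEM.
have i1 : P.-integrable setT (EFin \o cst (1 : R)).
  exact: finite_measure_integrable_cst.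
have i1e : P.-integrable setT (EFin \o cst (expR 1 : R)).
  exact: finite_measure_integrable_cst.
have iC : P.-integrable G (EFin \o (fun t => aC t * 1)).
  exact: (integrable_boundedM mG (measurable_coarse F_sub maC) aCM i1).
have iEe : P.-integrable G (EFin \o (fun t => aE t * expR 1)).
  apply: (integrable_boundedM mG (measurable_coarse F_sub maE) _ i1e
    (M := M * expR (M / 2))).
  by move=> t /aEM/andP[? ?]; rewrite ger0_norm.
have iQ : P.-integrable G (EFin \o (fun t => Q t * expR (9 * q t + 2 * r))).
  have -> : (fun t => Q t * expR (9 * q t + 2 * r)) =
      (fun t => Q t * expR (9 * q t + 2 * r)) \* cst 1.
    by apply/funext => t; rewrite /= mulr1.
  apply: (integrable_boundedM mG _ _ i1 (M := M * expR (9 * M + 2 * r))).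
    apply: (measurable_coarse F_sub); apply: measurable_funM => //.
    apply: measurableT_comp => //; apply: measurable_funD => //.
    exact: measurable_funM.
  move=> t Gt; have /andP[Q0 QtM] := QM t Gt.
  rewrite ger0_norm ?mulr_ge0 ?expR_ge0//; apply: ler_pM => //.
  by rewrite ler_expR lerD2r ler_pM2l// qM.
pose S t := \sum_(i < n) aL i t * (g t 0 i - m t 0 i).
have SE : EFin \o S =
    (fun t => \sum_(i < n) (aL i t * (g t 0 i - m t 0 i))%:E)%E.
  by apply/funext => t; rewrite /= sumEFin.
have iS : P.-integrable G (EFin \o S).
  by rewrite SE; apply: (integrable_sum mG) => i _; exact: (iL i).1.
have S0 : \int[P]_(t in G) S t = 0.
  rewrite /Rintegral -/(EFin \o S) SE integral_sum//; last first.
    by move=> i; exact: (iL i).1.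
  rewrite big1// => i _.
  have [iLi Li0] := iL i.
  rewrite -[LHS]fineK; last exact: integrable_fin_num.
  by move: Li0; rewrite /Rintegral => ->.
pose s t := norm2 (g t - m t) ^+ 2 / sigma ^+ 2.
pose Y t := S t + (aC t * 1 + aE t * expR (s t)).
have iCE : P.-integrable G (EFin \o (fun t => aC t * 1 + aE t * expR (s t))).
  by have := integrableD mG iC iE.
have iY : P.-integrable G (EFin \o Y) by have := integrableD mG iS iCE.
have X0 t : G t -> 0 <= X t.
  by move=> /QM/andP[Q0 _]; rewrite mulr_ge0 ?expR_ge0.
have XY t : G t -> X t <= Y t.
  move=> Gt; have /andP[Q0 QtM] := QM t Gt.
  have s0 : 0 <= s t by rewrite divr_ge0 ?sqr_ge0.
  have cs : dot (g t - m t) (w t) ^+ 2 <= q t * s t.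
    apply: le_trans (dot_cauchy_schwarz _ _) _.
    rewrite [leRHS](_ : _ = dot (g t - m t) (g t - m t) * dot (w t) (w t))//.
    by rewrite /q /s norm2_sqr; field; rewrite gt_eqF.
  have := ler_wpM2l Q0 (expR_le_mgf s0 (q0 t) r01 cs).
  move=> /le_trans; apply; rewrite /Y /S /aC /aE /aL.
  rewrite [leLHS](_ : _ = S t + (aC t * 1 + aE t * expR (s t)))//.
  rewrite !mulrDr mulr1 !mulrA -addrA; congr (_ + (_ + _)).
  by rewrite /S /dot mulr_sumr; apply: eq_bigr => i _; rewrite /aL !mxE; ring.
(* An integrable variable is measurable. *)
have mg i : measurable_fun setT (fun t => g t 0 i).
  by have [Z [/measurable_int/measurable_EFinP]] := g_mean i.
have mgm i : measurable_fun setT (fun t => (g t - m t) 0 i).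
  under eq_fun do rewrite !mxE; exact: measurable_funB.
have mX : measurable_fun setT X.
  apply: measurable_funM; first exact: (measurable_coarse F_sub).
  apply: measurableT_comp => //; apply: measurable_funD.
    by apply: measurable_dot => // i; exact: (measurable_coarse F_sub).
  apply: measurable_funM => //; apply: measurable_funM => //.
  under eq_fun do rewrite norm2_sqr; exact: measurable_dot.
have iX : P.-integrable G (EFin \o X).
  apply: (le_integrable mG _ _ iY).
    exact/measurable_EFinP/measurable_funTS.
  move=> t Gt; rewrite lee_fin !ger0_norm ?X0 ?XY//.
  exact: le_trans (X0 t Gt) (XY t Gt).
split; first exact: iX.
apply: le_trans (le_Rintegral mG iX iY XY) _.
rewrite (RintegralD mG iS iCE) S0 add0r.
apply: le_trans (Rintegral_leD2l mG iC iE iEe EE) _.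
have iCEe : P.-integrable G (EFin \o (fun t => aC t * 1 + aE t * expR 1)).
  by have := integrableD mG iC iEe.
apply: (le_Rintegral mG iCEe iQ).
move=> t Gt; have /andP[Q0 QtM] := QM t Gt.
rewrite mulr1 -mulrA -mulrDr; apply: ler_wpM2l => //.
exact: mgf_coef_le.
Qed.

End ConditionalMgf.

(** * A maximal inequality *)

Section MaximalInequality.
Context {d} {T : measurableType d} {R : realType} (P : probability T R).

Lemma markov_truncated (D : set T) (f : T -> R) (h : R) :
  measurable D -> measurable_fun setT f -> (forall t, 0 <= f t) ->
  P.-integrable D (EFin \o f) ->
  \int[P]_(t in D `&` [set t | f t <= h]) f t +
    h * fine (P (D `\` [set t | f t <= h])) <= \int[P]_(t in D) f t.
Proof.
move=> mD mf f0 iD.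
have mh : measurable [set t | f t <= h] by exact: measurable_sublevel.
have m1 : measurable (D `&` [set t | f t <= h]) by exact: measurableI.
have m2 : measurable (D `\` [set t | f t <= h]) by exact: measurableD.
rewrite -[X in _ <= \int[_]_(_ in X) _](setUIDK D [set t | f t <= h]).
rewrite Rintegral_setU//; last 2 first.
- by rewrite setUIDK.
- by apply/disj_setPS => t [[_ ht] [_ /(_ ht)]].
rewrite lerD2l -Rintegral_cst//; apply: le_Rintegral => //.
- exact: finite_measure_integrable_cst.
- by apply: integrableS iD => //; exact: subDsetl.
- by move=> t [_ /negP]; rewrite -ltNge => /ltW.
Qed.

(** Doob's argument: B k is the event that the level h has not been exceeded up to
    time k, and int_(B k) M_k + h P(~ B k) does not increase with k.  At the first
    exceedance, [markov_truncated] exchanges the integral for h times the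
    probability.  The supermartingale property is used on the events B k only,
    where M_k is bounded by h. *)
Lemma maximal_inequality (M : nat -> T -> R) (h c : R) :
  0 < h -> (forall k, measurable_fun setT (M k)) -> (forall k t, 0 <= M k t) ->
  let B k := [set t | forall j, (j <= k)%N -> (M j t <= h)%R] in
  P.-integrable setT (EFin \o M 0) -> \int[P]_t M 0 t <= c ->
  (forall k, P.-integrable (B k) (EFin \o M k.+1)) ->
  (forall k, \int[P]_(t in B k) M k.+1 t <= \int[P]_(t in B k) M k t) ->
  ((1 - c / h)%:E <= P [set t | forall j, (M j t <= h)%R])%E.
Proof.
move=> h0 mM M0 B i0 int0 iM intM.
have mh k : measurable [set t | M k t <= h] by exact: measurable_sublevel.
have B0 : B 0 = [set t | M 0 t <= h].
  apply/seteqP; split => t /= Bt; first exact: Bt.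
  by move=> j; rewrite leqn0 => /eqP ->.
have BS k : B k.+1 = B k `&` [set t | M k.+1 t <= h].
  apply/seteqP; split => t /= => [Bt|[Bt Mt] j].
    by split => [j jk|]; apply: Bt => //; exact: leqW.
  by rewrite leq_eqVlt => /predU1P[->//|]; rewrite ltnS; exact: Bt.
have mB k : measurable (B k).
  by elim: k => [|k IH]; rewrite ?B0// BS; exact: measurableI.
have claim k : \int[P]_(t in B k) M k t + h * fine (P (~` B k)) <= c.
  elim: k => [|k IH].
    have := markov_truncated h measurableT (mM 0%N) (M0 0%N) i0.
    by rewrite setTI setTD -B0 => /le_trans; apply.
  have := markov_truncated h (mB k) (mM k.+1) (M0 k.+1) (iM k).
  rewrite -BS => mt.
  have -> : P (~` B k.+1) =
      (P (B k `\` [set t | (M k.+1 t <= h)%R]) + P (~` B k))%E.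
    rewrite -measureU//.
    - congr (P _); rewrite BS setCI; apply/seteqP; split => t /=.
        by move=> [?|?]; [right|have [?|?] := pselect (B k t); [left|right]].
      by move=> [[? ?]|?]; [right|left].
    - by apply: measurableD.
    - exact: measurableC.
    - by apply/seteqP; split => t // -[[Bt _] /(_ Bt)].
  rewrite fineD ?fin_num_measure//; last 2 first.
  - by apply: measurableD.
  - exact: measurableC.
  by have := intM k; lra.
have PB k : ((1 - c / h)%:E <= P (B k))%E.
  have : 0 <= \int[P]_(t in B k) M k t by apply: Rintegral_ge0.
  have := claim k; rewrite probability_setC//.
  have : P (B k) \is a fin_num by rewrite fin_num_measure.
  case: (P (B k)) => // p _; rewrite -EFinB lee_fin /= => h1 h2.
  have : h * (1 - p) <= c by lra.
  by rewrite mulrC -ler_pdivlMr//; lra.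
have -> : [set t | forall j, M j t <= h] = \bigcap_k B k.
  apply/seteqP; split => t /= Bt; first by move=> k _ j _.
  by move=> j; exact: (Bt j I j).
have cB : P (B k) @[k --> \oo] --> P (\bigcap_k B k).
  apply: nonincreasing_cvg_mu => //.
  - by apply: le_lt_trans (probability_le1 _ _) _; rewrite ?ltry.
  - exact: bigcapT_measurable.
  - move=> i j ij; apply/subsetPset => t Bt l li.
    by apply: Bt; exact: leq_trans ij.
rewrite -(cvg_lim _ cB)//; apply: lime_ge.
  by apply/cvg_ex; eexists; exact: cB.
by apply: nearW => k; exact: PB.
Qed.

End MaximalInequality.

(** * Borel measurability in R^n *)

Section BorelRn.
Context {R : realType} {n : nat}.

Lemma continuous_borelRn (h : 'rV[R]_n -> R) :
  continuous h -> measurable_fun [set: borelRn R n] (h : borelRn R n -> R).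
Proof.
move=> ch; apply: (measurability _ (RGenOpens.measurableE R)).
move=> _ [_ [a [b ->]] <-]; rewrite setTI; apply: sub_sigma_algebra.
exact/open_comp/interval_open.
Qed.

Lemma measurable_borelRn_coord (i : 'I_n) :
  measurable_fun [set: borelRn R n] (fun v : borelRn R n => (v : 'rV[R]_n) 0 i).
Proof. apply: continuous_borelRn; exact: coord_continuous. Qed.

(** An open set is the union of the countably many balls with rational centre and
    radius 1 / (m + 1) that it contains, and for the sup norm the preimage of a
    ball is given by conditions on the coordinates. *)
Lemma measurable_borelRn d (T : measurableType d) (h : T -> 'rV[R]_n) :
  (forall i, measurable_fun setT (fun t => h t 0 i)) ->
  measurable_fun setT (h : T -> borelRn R n).
Proof.
move=> mh.
apply: (@measurability _ _ T (borelRn R n) setT h (@open 'rV[R]_n)) => //.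
move=> _ [U oU <-]; rewrite setTI.
pose F (qe : 'rV[rat]_n * nat) := [set t |
  (forall v : 'rV[R]_n,
    (forall i, `|ratr (qe.1 0 i) - v 0 i| < qe.2.+1%:R^-1) -> U v) /\
  (forall i, `|ratr (qe.1 0 i) - h t 0 i| < qe.2.+1%:R^-1)].
have -> : h @^-1` U = \bigcup_qe F qe.
  apply/seteqP; split => [t Ut|t [qe _ [Uqe]]]; last exact: Uqe.
  have [e /= e0 eU] : exists2 e : R, 0 < e & ball (h t) e `<=` U.
    by have /nbhs_ballP[e e0 eU] := open_nbhs_nbhs (conj oU Ut); exists e.
  have [m me] : exists m : nat, (m.+1%:R^-1 : R) < e / 2.
    have [m hm] := ltr_add_invr (ltac:(by rewrite divr_gt0) : (0 : R) < e / 2).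
    by exists m; rewrite add0r in hm.
  have /choice[q hq] : forall i : 'I_n, exists q : rat,
      `|ratr q - h t 0 i| < m.+1%:R^-1.
    move=> i; have m0 : h t 0 i - m.+1%:R^-1 < h t 0 i + m.+1%:R^-1 :> R.
      by rewrite ltrBlDr -addrA ltrDl addr_gt0 ?invr_gt0.
    have [q hq] := rat_in_itvoo m0; exists q.
    by move: hq; rewrite in_itv /= ltr_distl.
  exists (\row_i q i, m) => //; split => /= [v vq|i]; last by rewrite mxE.
  apply: eU; split => // j i; rewrite ord1 /ball /=.
  have := vq i; rewrite mxE => vqi.
  apply: le_lt_trans (ler_distD (ratr (q i)) _ _) _.
  rewrite [ltRHS]splitr; apply: ltrD; last exact: lt_trans vqi me.
  by rewrite distrC; exact: lt_trans (hq i) me.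
apply: countable_bigcupT_measurable => [|qe]; first exact: countableP.
have [D|nD] := pselect (forall v : 'rV[R]_n,
    (forall i, `|ratr (qe.1 0 i) - v 0 i| < qe.2.+1%:R^-1) -> U v); last first.
  by rewrite (_ : F qe = set0)//; apply/seteqP; split => t // -[].
have -> : F qe = \bigcap_(i in [set: 'I_n])
    [set t | `|ratr (qe.1 0 i) - h t 0 i| < qe.2.+1%:R^-1].
  apply/seteqP; split => [t [_ Ft] i _|t Ft]; first exact: Ft.
  by split => // i; exact: Ft.
apply: fin_bigcap_measurable; first exact: finite_finset.
move=> i _.
have mhi : measurable_fun setT (fun t => `|ratr (qe.1 0 i) - h t 0 i|).
  by apply: measurableT_comp => //; exact: measurable_funB.
have := mhi measurableT _ (measurable_itv `]-oo, qe.2.+1%:R^-1[).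
by rewrite setTI.
Qed.

Lemma norm2_le_norm (v : 'rV[R]_n) : norm2 v <= n%:R * `|v|.
Proof.
have vi i : `|v 0 i| <= `|v|.
  rewrite [leRHS]mx_normrE.
  exact: (le_bigmax _ (fun ij => `|v ij.1 ij.2|) (0, i)).
rewrite -(@ler_pXn2r _ 2) ?nnegrE ?norm2_ge0 ?mulr_ge0//.
rewrite norm2_sqr /dot exprMn.
apply: (@le_trans _ _ (\sum_(i < n) `|v| ^+ 2)).
  apply: ler_sum => i _; rewrite -expr2 -real_normK ?num_real//.
  by rewrite lerXn2r ?nnegrE.
rewrite sumr_const card_ord -[leLHS]mulr_natl.
apply: ler_wpM2r; first exact: sqr_ge0.
by rewrite -natrX ler_nat; case: (n) => // k; exact: leq_pmulr.
Qed.

Lemma coord_le_norm2 (v : 'rV[R]_n) i : `|v 0 i| <= norm2 v.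
Proof.
rewrite -(@ler_pXn2r _ 2) ?nnegrE ?norm2_ge0// norm2_sqr.
rewrite real_normK ?num_real// /dot (bigD1 i)//= -expr2.
by rewrite lerDl sumr_ge0// => j _; rewrite -expr2 sqr_ge0.
Qed.

(** The Lipschitz bound is stated for the Euclidean norm, while the topology comes
    from the sup norm; the two norms are compared by [norm2_le_norm] and
    [coord_le_norm2]. *)
Lemma gradient_continuous (f : 'rV[R]_n -> R) (L : R) (i : 'I_n) :
  0 < L -> smooth L f -> continuous (fun x => gradient f x 0 i).
Proof.
move=> L0 [_ fL] x; apply/(@cvgrPdist_lt _ _ _ _ (nbhs_filter x)) => e e0.
have d0 : 0 < e / (L * n.+1%:R) by rewrite divr_gt0 ?mulr_gt0.
have : nbhs x (ball x (e / (L * n.+1%:R))) by exact: nbhsx_ballx.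
apply: filterS => y; rewrite -ball_normE /= => xy.
have -> : gradient f x 0 i - gradient f y 0 i =
    (gradient f x - gradient f y) 0 i.
  by rewrite !mxE.
apply: le_lt_trans (coord_le_norm2 _ _) _.
apply: le_lt_trans (fL x y) _.
apply: (@le_lt_trans _ _ (L * (n.+1%:R * `|x - y|))).
  rewrite ler_pM2l//; apply: le_trans (norm2_le_norm _) _.
  by apply: ler_wpM2r => //; rewrite ler_nat.
by rewrite mulrA mulrC -ltr_pdivlMr ?mulr_gt0.
Qed.

End BorelRn.

(** * Step sizes and the compensator *)

Section StepSizes.
Context {R : realType}.
Variables (L sigma : R).
Hypotheses (L_gt0 : 0 < L) (sigma_gt0 : 0 < sigma).

(** The step of the hidden gradient descent, see [sgd_pointS]. *)
Definition stepsize (k : nat) : R :=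
  2 * Num.sqrt (Defs.eta L k) / Num.sqrt k%:R.

Lemma ln_nat_gt0 k : 0 < ln k.+2%:R :> R.
Proof. by rewrite ln_gt0// ltr1n. Qed.

Lemma ln_nat_le j k : (0 < j)%N -> (j <= k)%N -> ln j%:R <= ln k%:R :> R.
Proof.
move=> j0 jk; rewrite ler_ln ?posrE ?ltr0n ?ler_nat//.
exact: leq_trans jk.
Qed.

Lemma stepsizeE k : stepsize k = (2 * L * ln k.+2%:R * Num.sqrt k%:R)^-1.
Proof.
have l0 := ln_nat_gt0 k.
rewrite /stepsize /Defs.eta.
have -> : 1 / (16 * L ^+ 2 * ln k.+2%:R ^+ 2) =
    ((4 * L * ln k.+2%:R)^-1) ^+ 2 :> R.
  by rewrite exprVn !exprMn div1r -natrX.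
rewrite sqrtr_sqr gtr0_norm ?invr_gt0 ?mulr_gt0//.
have [->|k0] := eqVneq k 0%N; first by rewrite sqrtr0 !(mulr0, invr0).
have s0 : Num.sqrt k%:R != 0 :> R by rewrite gt_eqF// sqrtr_gt0 ltr0n lt0n.
by field; rewrite s0 !gt_eqF.
Qed.

Lemma stepsize_ge0 k : 0 <= stepsize k.
Proof.
rewrite stepsizeE invr_ge0 !mulr_ge0 ?sqrtr_ge0 ?(ltW L_gt0)//.
by rewrite ltW// ln_nat_gt0.
Qed.

Lemma stepsize_decr k : (0 < k)%N -> stepsize k.+1 <= stepsize k.
Proof.
move=> k0; rewrite !stepsizeE lef_pV2 ?posrE ?mulr_gt0 ?sqrtr_gt0 ?ltr0n
  ?ln_nat_gt0//.
apply: ler_pM; rewrite ?sqrtr_ge0 ?mulr_ge0 ?(ltW L_gt0)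
  ?(ltW (ln_nat_gt0 _))//.
  by apply: ler_wpM2l; [rewrite mulr_ge0 ?(ltW L_gt0)|exact: ln_nat_le].
by rewrite ler_sqrt// ler_nat.
Qed.

Lemma ln3_ge1 : 1 <= ln 3 :> R.
Proof. by rewrite -[leLHS]expRK ler_ln ?posrE ?expR_gt0// expR1_le3. Qed.

Lemma stepsize_le k : (0 < k)%N -> 2 * L * stepsize k <= 1.
Proof.
move=> k0; rewrite stepsizeE.
have k3 : 1 <= ln k.+2%:R :> R by apply: le_trans ln3_ge1 _; exact: ln_nat_le.
have s1 : 1 <= Num.sqrt k%:R :> R by rewrite -[leLHS]sqrtr1 ler_wsqrtr// ler1n.
rewrite ler_pdivrMr ?mul1r; last by rewrite !mulr_gt0//; lra.
rewrite -mulrA -[leLHS]mulr1 ler_pM2l ?mulr_gt0//.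
have := @ler_pM _ 1 (ln k.+2%:R) 1 (Num.sqrt k%:R) ler01 ler01 k3 s1.
by rewrite mulr1.
Qed.

(** 36 sigma^2 a_k^2 = 9 sigma^2 / (L^2 k ln(k+2)^2), and 1 / k <= 3 / (k + 2);
    whence the constant 27 in [compensator_incr]. *)
Definition kappa : R := 27 * sigma ^+ 2 / L ^+ 2.

(** A bounded telescoping majorant of the sum of 36 sigma^2 a_j^2 over
    1 <= j < k. *)
Definition compensator (k : nat) : R := kappa * ((ln 2)^-1 - (ln k.+1%:R)^-1).

Definition compensator_bound : R := kappa / ln 2.

Lemma kappa_ge0 : 0 <= kappa.
Proof. by apply: divr_ge0; [apply: mulr_ge0|]; rewrite ?sqr_ge0. Qed.

Lemma compensator1 : compensator 1 = 0.
Proof. by rewrite /compensator subrr mulr0. Qed.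

Lemma compensator_ge0 k : (0 < k)%N -> 0 <= compensator k.
Proof.
move=> k0; rewrite mulr_ge0 ?kappa_ge0// subr_ge0 lef_pV2 ?posrE.
- exact: ln_nat_le.
- by case: k k0 => // ? _; exact: ln_nat_gt0.
- exact: (ln_nat_gt0 0).
Qed.

Lemma compensator_le k : compensator k <= compensator_bound.
Proof.
apply: ler_wpM2l; first exact: kappa_ge0.
by rewrite gerBl invr_ge0 ln_ge0// ler1n.
Qed.

(** Both sides compare through ln(k+2) - ln(k+1) >= 1 / (k + 2). *)
Lemma compensator_incr k : (0 < k)%N ->
  36 * sigma ^+ 2 * stepsize k ^+ 2 <= compensator k.+1 - compensator k.
Proof.
move=> k0.
have kpos : 0 < k%:R :> R by rewrite ltr0n.
have a0 : 0 < ln k.+1%:R :> R by case: k k0 {kpos} => // k _; exact: ln_nat_gt0.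
have b0 := ln_nat_gt0 k.
have ab : ln k.+1%:R <= ln k.+2%:R :> R by exact: ln_nat_le.
have dab : (3 * k%:R)^-1 <= ln k.+2%:R - ln k.+1%:R :> R.
  apply: (@le_trans _ _ (k.+2%:R^-1)).
    rewrite lef_pV2 ?posrE ?mulr_gt0 ?ltr0n// -natrM ler_nat; lia.
  have h := @le_ln1Dx R (- k.+2%:R^-1).
  have e : 1 + - k.+2%:R^-1 = k.+1%:R / k.+2%:R :> R.
    apply: (@mulIf _ k.+2%:R); first by rewrite pnatr_eq0.
    by rewrite mulrBl mul1r mulVf ?divfK ?pnatr_eq0// -[k.+2%:R]natr1 addrK.
  have := h _; rewrite e ln_div ?posrE ?ltr0n// => hh.
  suff : - 1 < - k.+2%:R^-1 :> R by move=> /hh h1; rewrite -lerN2 opprB.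
  by rewrite ltrN2 invf_lt1 ?ltr0n// ltr1n.
have -> : compensator k.+1 - compensator k =
    kappa * ((ln k.+2%:R - ln k.+1%:R) / (ln k.+1%:R * ln k.+2%:R)).
  by rewrite /compensator; field; rewrite !gt_eqF//; exact: (ln_nat_gt0 0).
have -> : 36 * sigma ^+ 2 * stepsize k ^+ 2 =
    kappa * ((3 * k%:R)^-1 / (ln k.+2%:R * ln k.+2%:R)).
  rewrite stepsizeE exprVn exprMn sqr_sqrtr ?ler0n// /kappa.
  by field; rewrite !gt_eqF.
apply: ler_wpM2l; first exact: kappa_ge0.
apply: ler_pM => //.
- by rewrite invr_ge0 mulr_ge0 ?ltW.
- by rewrite lef_pV2 ?posrE ?mulr_gt0// ler_pM2r.
Qed.

(** Lowering the weight of the energy W from 1 / (1 + t1) to 1 / (1 + t2) frees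
    (t2 - t1) W / ((1 + t1) (1 + t2)), which covers a term quadratic in the new
    weight; the shift from t1 to t2 covers the constant term. *)
Lemma compensator_absorbs (t1 t2 a V W : R) :
  0 <= t1 -> 0 <= a -> a <= t2 - t1 -> 0 <= V -> V <= W ->
  W / (1 + t2) - t2 + (a * ((1 + t2)^-1 ^+ 2 * V) + a * (1 + t2)^-1) <=
  W / (1 + t1) - t1.
Proof.
move=> t10 a0 at12 V0 VW.
have p1 : 0 < 1 + t1 by lra.
have p2 : 0 < 1 + t2 by lra.
have e : (1 + t1)^-1 - (1 + t2)^-1 = (t2 - t1) * ((1 + t1)^-1 * (1 + t2)^-1).
  by field; rewrite !gt_eqF.
have l2 : 0 < (1 + t2)^-1 by rewrite invr_gt0.
have l1 : (1 + t2)^-1 <= (1 + t1)^-1 by rewrite lef_pV2 ?posrE//; lra.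
have l21 : (1 + t2)^-1 <= 1 by rewrite invf_le1//; lra.
move: l2 l1 l21 e; move: (1 + t1)^-1 (1 + t2)^-1 => u v v0 vu v1 e.
have h1 : a * (v ^+ 2 * V) <= (t2 - t1) * (u * v * W).
  apply: ler_pM => //; first by rewrite mulr_ge0// sqr_ge0.
  apply: ler_pM => //; first by rewrite sqr_ge0.
  by rewrite expr2 ler_pM2r.
have h2 : a * v <= t2 - t1.
  by rewrite -[leRHS]mulr1; apply: ler_pM => //; exact: ltW.
have : W * (u - v) = (t2 - t1) * (u * v * W) by rewrite e; ring.
lra.
Qed.

End StepSizes.

(** * The stochastic momentum method *)

Section Momentum.
Context {R : realType} {n : nat}.
Variables (f : 'rV[R]_n -> R) (L sigma : R) (xs x0 : 'rV[R]_n).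
Hypotheses (L_gt0 : 0 < L) (sigma_gt0 : 0 < sigma)
  (f_convex : convex_function [set: convex_lmodType 'rV[R]_n] f)
  (f_smooth : smooth L f)
  (xs_min : forall y, f xs <= f y).
Context {d dE : measure_display} {T : measurableType d} {E : measurableType dE}.
Variables (P : probability T R) (xi : nat -> {RV P >-> E})
  (g : 'rV[R]_n -> E -> 'rV[R]_n) (x : nat -> T -> 'rV[R]_n).
Hypotheses
  (g_meas : measurable_fun [set: borelRn R n * E]
    (fun p : borelRn R n * E => g p.1 p.2 : borelRn R n))
  (x_sgdm : sgdm L g xi x0 x)
  (g_mean : forall k (i : 'I_n), (1 <= k)%N ->
     cond_exp_eq P (noise_sigma xi k.-1)
       (fun t => g (x k t) (xi k t) 0 i)
       (fun t => gradient f (x k t) 0 i))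
  (g_exp : forall k, (1 <= k)%N ->
     cond_exp_le P (noise_sigma xi k.-1)
       (fun t => expR (norm2 (g (x k t) (xi k t) - gradient f (x k t)) ^+ 2
                       / sigma ^+ 2))
       (fun=> expR 1)).

Lemma noise_sub k : <<s noise_sigma xi k >> `<=` measurable.
Proof.
apply: smallest_sub; first exact: sigma_algebra_measurable.
apply: smallest_sub; first exact: sigma_algebra_measurable.
by move=> _ [i _ [B mB <-]]; exact: (measurable_funP (xi i) measurableT _ mB).
Qed.

Lemma noise_mono j k : (j <= k)%N ->
  <<s noise_sigma xi j >> `<=` <<s noise_sigma xi k >>.
Proof.
move=> jk; apply: sub_sigma_algebra2; apply: sub_sigma_algebra2.
by apply: bigcup_subset => i /= /andP[i1 ij]; rewrite i1 (leq_trans ij jk).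
Qed.

Lemma noise_measurable j k : (1 <= j <= k)%N ->
  measurable_fun [set: g_sigma_algebraType (noise_sigma xi k)]
    (xi j : g_sigma_algebraType (noise_sigma xi k) -> E).
Proof.
move=> jk _ B mB; rewrite setTI.
do 2 apply: sub_sigma_algebra; exists j => //; exists B => //.
by rewrite setTI.
Qed.

Lemma measurable_noise_mono d' (U : measurableType d') (h : T -> U) j k :
  (j <= k)%N ->
  measurable_wrt (noise_sigma xi j) h ->
  measurable_wrt (noise_sigma xi k) h.
Proof.
move=> jk mh _ A mA; have := mh measurableT A mA; exact: noise_mono.
Qed.

(** x_(k+1) is a function of xi_1, ..., xi_k. *)
Lemma iterate_measurable k j : (j <= k.+1)%N ->
  measurable_fun [set: g_sigma_algebraType (noise_sigma xi k)]
    (x j : g_sigma_algebraType (noise_sigma xi k) -> borelRn R n).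
Proof.
case: x_sgdm => x0E x1E xS.
elim: k j => [|k IH] j jk.
  suff -> : x j = cst x0 by exact: measurable_cst.
  by apply/funext => t; case: j jk => [|[|]] // _; rewrite ?x0E ?x1E.
move: jk; rewrite leq_eqVlt => /predU1P[->|jk]; last first.
  by apply: (measurable_noise_mono (leqnSn k)); exact: IH.
have m1 : measurable_fun [set: g_sigma_algebraType (noise_sigma xi k.+1)]
    (x k.+1 : g_sigma_algebraType (noise_sigma xi k.+1) -> borelRn R n).
  by apply: (measurable_noise_mono (leqnSn k)); exact: IH.
have m0 : measurable_fun [set: g_sigma_algebraType (noise_sigma xi k.+1)]
    (x k : g_sigma_algebraType (noise_sigma xi k.+1) -> borelRn R n).
  by apply: (measurable_noise_mono (leqnSn k)); apply: IH.
have mg : measurable_fun [set: g_sigma_algebraType (noise_sigma xi k.+1)]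
    ((fun t => g (x k.+1 t) (xi k.+1 t)) :
      g_sigma_algebraType (noise_sigma xi k.+1) -> borelRn R n).
  apply: (measurableT_comp g_meas
    (f := (fun p : borelRn R n * E => g p.1 p.2 : borelRn R n))
    (g := fun t : g_sigma_algebraType (noise_sigma xi k.+1) =>
            (x k.+1 t : borelRn R n, xi k.+1 t))).
  by apply: measurable_fun_pair => //; apply: noise_measurable; rewrite leqnn.
apply: measurable_borelRn => i.
have -> : (fun t => x k.+2 t 0 i) = (fun t => x k.+1 t 0 i
    + (k.+1%:R / k.+3%:R) * (x k.+1 t 0 i - x k t 0 i)
    - (2 * Num.sqrt (Defs.eta L k.+1) / (k.+3%:R * Num.sqrt k.+1%:R))
      * g (x k.+1 t) (xi k.+1 t) 0 i).
  by apply/funext => t; rewrite xS// !mxE.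
have c1 := measurableT_comp (@measurable_borelRn_coord R n i) m1.
have c0 := measurableT_comp (@measurable_borelRn_coord R n i) m0.
have cg := measurableT_comp (@measurable_borelRn_coord R n i) mg.
apply: measurable_funB; last by apply: measurable_funM => //.
apply: measurable_funD => //; apply: measurable_funM => //.
exact: measurable_funB.
Qed.

(** The iterate z_k of the hidden gradient descent. *)
Definition sgd_point (k : nat) (t : T) : 'rV[R]_n :=
  x k t + k%:R *: (x k t - x k.-1 t).

Definition noise (k : nat) (t : T) : 'rV[R]_n :=
  g (x k t) (xi k t) - gradient f (x k t).

(** The gap is that of the previous iterate, so that the energy at time k is
    known before the k-th gradient is drawn. *)
Definition energy (k : nat) (t : T) : R :=
  dot (sgd_point k t - xs) (sgd_point k t - xs)
  + 2 * stepsize L k * k%:R * (f (x k.-1 t) - f xs).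

Lemma sgd_pointS k t : (0 < k)%N ->
  sgd_point k.+1 t = sgd_point k t - stepsize L k *: g (x k t) (xi k t).
Proof.
move=> k0; case: x_sgdm => _ _ xS; rewrite /sgd_point xS//=.
apply/rowP => i; rewrite !mxE -!natr1 /stepsize.
have s0 : Num.sqrt k%:R != 0 :> R by rewrite gt_eqF// sqrtr_gt0 ltr0n.
field; rewrite s0 /=.
by rewrite -addrA -(natrD _ 1 1) -natrD pnatr_eq0 addn_eq0 andbF.
Qed.

Lemma energy_ge0 k t : 0 <= energy k t.
Proof.
by rewrite addr_ge0 ?dot_ge0// !mulr_ge0 ?stepsize_ge0 ?subr_ge0.
Qed.

Lemma energy_ge_dot k t :
  dot (sgd_point k t - xs) (sgd_point k t - xs) <= energy k t.
Proof. by rewrite lerDl !mulr_ge0 ?stepsize_ge0 ?subr_ge0. Qed.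

Lemma energy_step k t : (0 < k)%N ->
  energy k.+1 t <= energy k t
    - 2 * stepsize L k * dot (noise k t) (sgd_point k t - xs)
    + 4 * stepsize L k ^+ 2 * dot (noise k t) (noise k t).
Proof.
move=> k0.
have h := momentum_step L_gt0 f_convex f_smooth xs_min
  (erefl : sgd_point k t = x k t + k%:R *: (x k t - x k.-1 t))
  (erefl : noise k t = g (x k t) (xi k t) - gradient f (x k t))
  (stepsize_ge0 L_gt0 k) (stepsize_le L_gt0 k0) (ler0n R k).
rewrite -sgd_pointS// in h.
have Dk : 0 <= (k%:R + 1) * (f (x k t) - f xs).
  by rewrite mulr_ge0 ?subr_ge0// addr_ge0.
have := ler_wpM2r Dk (stepsize_decr L_gt0 k0).
by rewrite /energy /= -natr1; move: h; lra.
Qed.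

(** With T_k the compensator, the weight 1 / (1 + T_k) pays for the noise that
    is proportional to the energy, and the shift by T_k for the constant part. *)
Definition potential (k : nat) (t : T) : R :=
  expR (energy k t / (1 + compensator L sigma k) - compensator L sigma k).

Lemma objective_measurable j k : (j <= k.+1)%N ->
  measurable_wrt (noise_sigma xi k) (fun t => f (x j t)).
Proof.
move=> jk; have cf : continuous f.
  by move=> y; apply: differentiable_continuous; exact: f_smooth.1.
exact: (measurableT_comp (continuous_borelRn cf) (iterate_measurable jk)).
Qed.

Lemma iterate_coord_measurable j k i : (j <= k.+1)%N ->
  measurable_wrt (noise_sigma xi k) (fun t => x j t 0 i).
Proof.
move=> jk.
exact: (measurableT_comp (@measurable_borelRn_coord R n i)
  (iterate_measurable jk)).
Qed.

Lemma sgd_point_measurable k i :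
  measurable_wrt (noise_sigma xi k) (fun t => (sgd_point k.+1 t - xs) 0 i).
Proof.
have -> : (fun t => (sgd_point k.+1 t - xs) 0 i) =
    (fun t => x k.+1 t 0 i + k.+1%:R * (x k.+1 t 0 i - x k t 0 i) - xs 0 i).
  by apply/funext => t; rewrite !mxE.
apply: measurable_funB => //; apply: measurable_funD.
  exact: iterate_coord_measurable.
apply: measurable_funM => //; apply: measurable_funB;
  exact: iterate_coord_measurable.
Qed.

Lemma energy_measurable k :
  measurable_wrt (noise_sigma xi k) (energy k.+1).
Proof.
apply: measurable_funD.
  by apply: measurable_dot => i; exact: sgd_point_measurable.
apply: measurable_funM => //; apply: measurable_funB => //.
exact: objective_measurable.
Qed.

Lemma potential_measurable k :
  measurable_wrt (noise_sigma xi k) (potential k.+1).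
Proof.
apply: measurableT_comp => //; apply: measurable_funB => //.
by apply: measurable_funM => //; exact: energy_measurable.
Qed.

(** The supermartingale property, on events of the past where the potential is
    bounded.  By [energy_step], the new potential is at most
    Q exp (<e, w> + r |e|^2 / sigma^2), where Q is built from the old energy with
    the new weight and shift; [cond_mgf_le] integrates the noise out and
    [compensator_absorbs] turns the result into the old potential. *)
Lemma potential_step k (G : set T) (h : R) :
  <<s noise_sigma xi k >> G -> (forall t, G t -> potential k.+1 t <= h) ->
  P.-integrable G (EFin \o potential k.+2) /\
  \int[P]_(t in G) potential k.+2 t <= \int[P]_(t in G) potential k.+1 t.
Proof.
move=> FG Gh.
set K := k.+1.
pose a := stepsize L K.
pose t1 := compensator L sigma K; pose t2 := compensator L sigma K.+1.
pose l := (1 + t2)^-1.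
pose Q t := expR (energy K t / (1 + t2) - t2).
pose w t := (- (2 * l * a)) *: (sgd_point K t - xs).
pose r := 4 * l * a ^+ 2 * sigma ^+ 2.
have t10 : 0 <= t1 by exact: compensator_ge0.
have t12 : 36 * sigma ^+ 2 * a ^+ 2 <= t2 - t1 by exact: compensator_incr.
have sa0 : 0 <= sigma ^+ 2 * a ^+ 2 by rewrite mulr_ge0 ?sqr_ge0.
have t2p : 0 < 1 + t2 by lra.
have l0 : 0 < l by rewrite invr_gt0.
have lt2 : l * (1 + t2) = 1 by rewrite mulVf// gt_eqF.
(* The weight l is at most 1 / (36 sigma^2 a^2), whatever the step. *)
have r01 : 0 <= r <= 1 / 2.
  have rE : r = l * (4 * (sigma ^+ 2 * a ^+ 2)) by rewrite /r; ring.
  apply/andP; split; first by rewrite rE mulr_ge0 ?(ltW l0)//; lra.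
  have : l * (4 * (sigma ^+ 2 * a ^+ 2)) <= l * ((1 + t2) / 2).
    by rewrite ler_pM2l//; lra.
  by rewrite rE; move: lt2; lra.
have /andP[r0 _] := r01.
pose q t := sigma ^+ 2 * dot (w t) (w t).
have qE t : q t = sigma ^+ 2 * (2 * l * a) ^+ 2 *
    dot (sgd_point K t - xs) (sgd_point K t - xs).
  by rewrite /q dotZl dotZr; ring.
have a36 : 0 <= 36 * sigma ^+ 2 * a ^+ 2 by rewrite -mulrA mulr_ge0.
have Qq t : Q t * expR (9 * q t + 2 * r) <= potential K t.
  rewrite -expRD ler_expR.
  have := @compensator_absorbs R t1 t2 (36 * sigma ^+ 2 * a ^+ 2) _ _
    t10 a36 t12 (dot_ge0 (sgd_point K t - xs)) (energy_ge_dot K t).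
  move=> h36; apply: le_trans h36.
  rewrite -/l qE /r lerD2l.
  have : 0 <= l * (sigma ^+ 2 * a ^+ 2) by rewrite mulr_ge0// ltW.
  lra.
have Q0 t : 0 <= Q t by exact: expR_ge0.
have q0 t : 0 <= q t by rewrite /q mulr_ge0 ?sqr_ge0 ?dot_ge0.
have t20 : 0 <= t2 by lra.
(* A bound on the potential bounds Q and exp (9 q), as Q >= exp (- t2). *)
have QM t : G t -> 0 <= Q t <= h * expR t2.
  move=> /Gh; rewrite Q0 /= => Kh.
  have e1 : 1 <= expR (9 * q t + 2 * r).
    by rewrite -[leLHS]expR0 ler_expR addr_ge0// mulr_ge0.
  have : Q t <= h.
    apply: le_trans Kh; apply: le_trans (Qq t).
    by rewrite -[leLHS]mulr1 ler_wpM2l.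
  move=> Qh; apply: le_trans Qh _; rewrite -[leLHS]mulr1 ler_wpM2l//.
    exact: le_trans (expR_ge0 _) Kh.
  by rewrite -expR0 ler_expR.
have qM t : G t -> q t <= h * expR t2.
  move=> /Gh Kh; rewrite mulrC -ler_pdivrMl ?expR_gt0// -expRN.
  apply: le_trans Kh; apply: le_trans (Qq t).
  apply: ler_pM; rewrite ?expR_ge0//.
    rewrite ler_expR lerDr.
    by rewrite mulr_ge0 ?energy_ge0// invr_ge0 ltW.
  by apply: le_trans (expR_ge1Dx _); have := q0 t; lra.
have F_sub := @noise_sub k.
have mgrad i : measurable_fun setT (fun t => gradient f (x K t) 0 i).
  have mK : measurable_fun setT (x K : T -> borelRn R n).
    by apply: (measurable_coarse F_sub); exact: iterate_measurable.
  have cg := gradient_continuous (i := i) L_gt0 f_smooth.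
  exact: (measurableT_comp (continuous_borelRn cg) mK).
have mQ : measurable_wrt (noise_sigma xi k) Q.
  apply: measurableT_comp => //; apply: measurable_funB => //.
  by apply: measurable_funM => //; exact: energy_measurable.
have mw i : measurable_wrt (noise_sigma xi k) (fun t => w t 0 i).
  have -> : (fun t => w t 0 i) =
      (fun t => - (2 * l * a) * (sgd_point K t - xs) 0 i).
    by apply/funext => t; rewrite /w mxE.
  by apply: measurable_funM => //; exact: sgd_point_measurable.
have [iX XQ] := cond_mgf_le F_sub sigma_gt0 mgrad
  (fun i => g_mean (k := K) i isT) (g_exp (k := K) isT) FG r01 mQ mw QM qM.
have mG := F_sub _ FG.
have KX t : potential K.+1 t <= Q t * expR (dot (noise K t) (w t) +
     r * (norm2 (noise K t) ^+ 2 / sigma ^+ 2)).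
  rewrite -expRD ler_expR addrAC lerD2r.
  have := energy_step t (ltn0Sn k); rewrite -/K -/a => es.
  rewrite -/t2 norm2_sqr dotZr.
  have -> : r * (dot (noise K t) (noise K t) / sigma ^+ 2) =
      l * (4 * a ^+ 2 * dot (noise K t) (noise K t)).
    by rewrite /r; field; rewrite gt_eqF.
  have := ler_wpM2l (ltW l0) es; rewrite /l; lra.
have mP j : measurable_fun setT (potential j.+1).
  by apply: (measurable_coarse (@noise_sub j)); exact: potential_measurable.
have iP2 : P.-integrable G (EFin \o potential K.+1).
  apply: (le_integrable mG _ _ iX).
    exact/measurable_EFinP/measurable_funTS.
  move=> t Gt; rewrite lee_fin ger0_norm ?expR_ge0//.
  by apply: le_trans (KX t) _; exact: ler_norm.
have i1 : P.-integrable setT (EFin \o cst (1 : R)).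
  exact: finite_measure_integrable_cst.
have iP1 : P.-integrable G (EFin \o potential K).
  have -> : potential K = potential K \* cst 1.
    by apply/funext => t; rewrite /= mulr1.
  apply: (integrable_boundedM mG (mP k) _ i1 (M := h)).
  by move=> t Gt; rewrite ger0_norm ?Gh ?expR_ge0.
have iQ : P.-integrable G (EFin \o (fun t => Q t * expR (9 * q t + 2 * r))).
  apply: (le_integrable mG _ _ iP1).
    apply/measurable_EFinP/measurable_funTS/(measurable_coarse F_sub).
    apply: measurable_funM => //; apply: measurableT_comp => //.
    apply: measurable_funD => //; apply: measurable_funM => //.
    by apply: measurable_funM => //; exact: measurable_dot.
  move=> t Gt; rewrite lee_fin ger0_norm ?mulr_ge0 ?expR_ge0//.
  by apply: le_trans (Qq t) _; exact: ler_norm.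
split; first exact: iP2.
apply: le_trans (le_Rintegral mG iP2 iX (fun t _ => KX t)) _.
apply: le_trans XQ _.
exact: (le_Rintegral mG iQ iP1 (fun t _ => Qq t)).
Qed.

(** As x_1 = x_0, the energy at time 1 is a constant. *)
Definition energy1 : R :=
  dot (x0 - xs) (x0 - xs) + 2 * stepsize L 1 * (f x0 - f xs).

Lemma potential1 t : potential 1 t = expR energy1.
Proof.
case: x_sgdm => x0E x1E _.
rewrite /potential compensator1 addr0 divr1 subr0 /energy /sgd_point.
by rewrite x0E x1E subrr scaler0 addr0 mulr1.
Qed.

(** The potential starts at the constant exp energy1, so it exceeds
    exp energy1 / beta at some time with probability at most beta. *)
Lemma potential_maximal (beta : R) : 0 < beta ->
  ((1 - beta)%:E <=
   P [set t | forall k, (potential k.+1 t <= expR energy1 / beta)%R])%E.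
Proof.
move=> b0.
have c0 : 0 < expR energy1 / beta by rewrite divr_gt0 ?expR_gt0.
have mP k : measurable_fun setT (potential k.+1).
  by apply: (measurable_coarse (@noise_sub k)); exact: potential_measurable.
have E1 : potential 1 = cst (expR energy1).
  by apply/funext => t; rewrite potential1.
have i1 : P.-integrable setT (EFin \o potential 1).
  by rewrite E1; exact: finite_measure_integrable_cst.
have int1 : \int[P]_t potential 1 t <= expR energy1.
  rewrite E1.
  rewrite (Rintegral_cst P measurableT).
  have /(congr1 fine) /= PT := probability_setT P.
  by rewrite [fine _]PT mulr1.
pose B k := [set t | forall j, (j <= k)%N ->
  (potential j.+1 t <= expR energy1 / beta)%R].
have stepB k : P.-integrable (B k) (EFin \o potential k.+2) /\
    \int[P]_(t in B k) potential k.+2 t <= \int[P]_(t in B k) potential k.+1 t.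
  apply: (potential_step (h := expR energy1 / beta)); last by move=> t; exact.
  have -> : B k = \bigcap_(j in [set j | (j <= k)%N])
      [set t | potential j.+1 t <= expR energy1 / beta].
    by apply/seteqP; split => t Ht j /=; exact: Ht.
  apply: (@bigcap_measurableType _ (g_sigma_algebraType (noise_sigma xi k))).
  move=> j /= jk.
  apply: (@measurable_sublevel _ (g_sigma_algebraType (noise_sigma xi k))).
  by apply: (measurable_noise_mono jk); exact: potential_measurable.
have := maximal_inequality c0 mP (fun k t => expR_ge0 _) i1 int1
  (fun k => (stepB k).1) (fun k => (stepB k).2).
rewrite (_ : expR energy1 / (expR energy1 / beta) = beta)//.
by rewrite invf_div mulrCA divff ?mulr1// gt_eqF// expR_gt0.
Qed.

(** The level beta turns into the additive term ln (1 / beta) for the energy, and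
    the coefficient of the gap in the energy at time k + 2 is
    sqrt (k + 2) / (L ln (k + 4)).  The factor 2 accounts for
    ln (k + 4) <= 2 ln (k + 3). *)
Lemma potential_gap (beta : R) k t : 0 < beta < 1 ->
  potential k.+2 t <= expR energy1 / beta ->
  f (x k.+1 t) - f xs <=
    (2 * L * (1 + compensator_bound L sigma)) *
    (energy1 + compensator_bound L sigma + ln (1 / beta)) *
    ln k.+3%:R / Num.sqrt k.+2%:R.
Proof.
move=> /andP[b0 b1] hp.
set t2 := compensator_bound L sigma.
have t0 : 0 <= compensator L sigma k.+2 by exact: compensator_ge0.
have tb : compensator L sigma k.+2 <= t2 by exact: compensator_le.
have e10 : 0 <= energy1.
  by rewrite addr_ge0 ?dot_ge0// !mulr_ge0 ?stepsize_ge0 ?subr_ge0.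
have lb : 0 <= ln (1 / beta).
  by rewrite ln_ge0// ler_pdivlMr// mul1r ltW.
have Wle : energy k.+2 t <= (1 + t2) * (energy1 + t2 + ln (1 / beta)).
  move: hp; rewrite /potential.
  have -> : expR energy1 / beta = expR (energy1 + ln (1 / beta)).
    by rewrite expRD lnK ?posrE ?divr_gt0// mul1r.
  rewrite ler_expR lerBlDr ler_pdivrMr; last by lra.
  move=> /le_trans; apply; rewrite mulrC.
  by apply: ler_pM; lra.
have D0 : 0 <= f (x k.+1 t) - f xs by rewrite subr_ge0.
have Wge : 2 * stepsize L k.+2 * k.+2%:R * (f (x k.+1 t) - f xs) <=
    energy k.+2 t.
  by rewrite /energy /= lerDr dot_ge0.
have s0 : 0 < Num.sqrt k.+2%:R :> R by rewrite sqrtr_gt0.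
have l4 := ln_nat_gt0 (R := R) k.+2.
have e2 : 2 * stepsize L k.+2 * k.+2%:R = Num.sqrt k.+2%:R / (L * ln k.+4%:R).
  rewrite stepsizeE// -[X in 2 * _ * X](@sqr_sqrtr R k.+2%:R)//.
  by field; rewrite !gt_eqF.
have ln4 : ln k.+4%:R <= 2 * ln k.+3%:R :> R.
  rewrite mulr_natl mulr2n -lnM ?posrE ?ltr0n//.
  rewrite ler_ln ?posrE ?mulr_gt0 ?ltr0n//.
  by rewrite -natrM ler_nat mulSn -[k.+4]addn1 leq_add2l muln_gt0.
rewrite ler_pdivlMr//.
have h1 : (f (x k.+1 t) - f xs) * Num.sqrt k.+2%:R <=
    energy k.+2 t * (L * ln k.+4%:R).
  rewrite -ler_pdivrMr ?mulr_gt0//; move: Wge; rewrite e2.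
  by rewrite mulrAC [_ * (f _ - _)]mulrC.
apply: le_trans h1 _.
have -> : 2 * L * (1 + t2) * (energy1 + t2 + ln (1 / beta)) * ln k.+3%:R =
   ((1 + t2) * (energy1 + t2 + ln (1 / beta))) * (L * (2 * ln k.+3%:R)) by ring.
apply: ler_pM => //; first exact: energy_ge0.
  by rewrite mulr_ge0// ltW.
by rewrite ler_pM2l.
Qed.

End Momentum.

Theorem theorem1 (R : realType) (n : nat) (f : 'rV[R]_n -> R)
    (L sigma fstar : R) (x0 : 'rV[R]_n)
    (L_gt0 : 0 < L) (sigma_gt0 : 0 < sigma)
    (f_convex : convex_function [set: convex_lmodType 'rV[R]_n] f)
    (f_smooth : smooth L f)
    (f_min : exists2 xstar, f xstar = fstar & forall y, fstar <= f y) :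
  exists C1 C2 : R,
  forall (d dE : measure_display) (T : measurableType d)
    (E : measurableType dE) (P : probability T R) (xi : nat -> {RV P >-> E})
    (g : 'rV[R]_n -> E -> 'rV[R]_n) (x : nat -> T -> 'rV[R]_n),
  measurable_fun [set: borelRn R n * E]
    (fun p : borelRn R n * E => g p.1 p.2 : borelRn R n) ->
  sgdm L g xi x0 x ->
  (forall k (i : 'I_n), (1 <= k)%N ->
     cond_exp_eq P (noise_sigma xi k.-1)
       (fun t => g (x k t) (xi k t) 0 i)
       (fun t => gradient f (x k t) 0 i)) ->
  (forall k, (1 <= k)%N ->
     cond_exp_le P (noise_sigma xi k.-1)
       (fun t => norm2 (g (x k t) (xi k t)) ^+ 2)
       (fun t => norm2 (gradient f (x k t)) ^+ 2 + sigma ^+ 2)) ->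
  (forall k, (1 <= k)%N ->
     cond_exp_le P (noise_sigma xi k.-1)
       (fun t => expR (norm2 (g (x k t) (xi k t) - gradient f (x k t)) ^+ 2
                       / sigma ^+ 2))
       (fun=> expR 1)) ->
  (forall beta : R, 0 < beta < 1 / 2 ->
     ((1 - 2 * beta)%:E <=
      P [set t | forall k, (1 <= k)%N ->
           (f (x k t) - fstar <=
            (C1 + C2 * ln (1 / beta)) * ln k.+2%:R
            / Num.sqrt k.+1%:R)%R])%E) /\
  (forall (beta : R) (tau : T -> nat), 0 < beta < 1 / 2 ->
     stopping_time x tau ->
     ((1 - 2 * beta)%:E <=
      P [set t | (f (x (tau t) t) - fstar <=
            (C1 + C2 * ln (1 / beta)) * ln (tau t).+2%:R
            / Num.sqrt (tau t).+1%:R)%R])%E).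
Proof.
have [xs fxs fs_min] := f_min.
have xs_min y : f xs <= f y by rewrite fxs.
pose C := 2 * L * (1 + compensator_bound L sigma).
exists (C * (energy1 f L xs x0 + compensator_bound L sigma)), C.
move=> d dE T E P xi g x g_meas x_sgdm g_mean _ g_exp.
pose c beta k : R := (C * (energy1 f L xs x0 + compensator_bound L sigma) +
  C * ln (1 / beta)) * ln k.+2%:R / Num.sqrt k.+1%:R.
pose A beta k := [set t | f (x k t) - fstar <= c beta k].
have mA beta k : measurable (A beta k).
  apply: measurable_sublevel.
  apply: measurable_funB => //.
  apply: (measurable_coarse (@noise_sub R _ _ _ _ P xi k)).
  exact: (objective_measurable f_smooth g_meas x_sgdm).
have mI beta : measurable [set t | forall k, (1 <= k)%N -> A beta k t].
  rewrite (_ : [set t | _] = \bigcap_(k in [set k | (1 <= k)%N]) A beta k)//.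
  by apply: bigcap_measurableType => k _.
have PI beta : 0 < beta < 1 / 2 ->
    ((1 - 2 * beta)%:E <= P [set t | forall k, (1 <= k)%N -> A beta k t])%E.
  move=> /andP[b0 b1].
  apply: (@le_trans _ _ (1 - beta)%:E); first by rewrite lee_fin; lra.
  apply: le_trans (potential_maximal L_gt0 sigma_gt0 f_convex f_smooth xs_min
    g_meas x_sgdm g_mean g_exp b0) _.
  have mM : measurable [set t | forall k, potential f L sigma xs x k.+1 t <=
      expR (energy1 f L xs x0) / beta].
    rewrite (_ : [set t | _] = \bigcap_k
        [set t | potential f L sigma xs x k.+1 t <=
          expR (energy1 f L xs x0) / beta]); last first.
      by apply/seteqP; split => t Ht k => [_|]; exact: (Ht k).
    apply: bigcapT_measurable => k; apply: (@noise_sub _ _ _ _ _ P xi k).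
    apply: (@measurable_sublevel _ (g_sigma_algebraType (noise_sigma xi k))).
    exact: (potential_measurable sigma xs f_smooth g_meas x_sgdm).
  apply: le_measure; rewrite ?inE// => t Mt [|k] // _.
  have b01 : 0 < beta < 1 by rewrite b0 /=; lra.
  have := potential_gap L_gt0 xs_min b01 (Mt k.+1).
  by rewrite /A /= -fxs /c /C -mulrDr.
split=> [beta b01|beta tau b01 [tau1 tau_stop]]; first exact: PI.
(* The bound at all times covers the bound at time tau; what remains is that the
   latter event is measurable, which holds on each piece tau = k. *)
have mtau k : measurable [set t | tau t = k].
  have mle j : measurable [set t | (tau t <= j)%N].
    have := tau_stop j.
    apply: smallest_sub; first exact: sigma_algebra_measurable.
    move=> _ [i _ [B mB <-]].
    apply: (@noise_sub _ _ _ _ _ P xi i).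
    exact: (iterate_measurable g_meas x_sgdm (leqnSn i)).
  case: k => [|k].
    rewrite (_ : [set t | _] = set0)//; apply/seteqP; split => t //= t0.
    by have := tau1 t; rewrite t0.
  rewrite (_ : [set t | _] =
      [set t | (tau t <= k.+1)%N] `\` [set t | (tau t <= k)%N]).
    exact: measurableD.
  apply/seteqP; split => t /=; first by move=> ->; split => //; lia.
  by move=> [? ?]; lia.
apply: le_trans (PI beta b01) _.
rewrite (_ : [set t | f (x (tau t) t) - fstar <= _] =
  \bigcup_k ([set t | tau t = k] `&` A beta k)); last first.
  apply/seteqP; split => t /=; first by move=> At; exists (tau t).
  by move=> [k _ [<-]].
apply: le_measure; rewrite ?inE//.
  by apply: bigcupT_measurable => k; exact: measurableI.
by move=> t At; exists (tau t) => //; split => //; exact: At.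
Qed.
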